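(* Let $(X_i)_{i=1}^\infty$ be independent with $X_i\sim\mathrm{Exp}(i)$ and $M=\sup_{i\ge1}X_i$. Then for every integer $k\ge1$, $$ \begin{aligned} E(M^k)=k!(-6)^k\Bigg(&\binom{2k-1}{k}-\frac{2\pi}{3\sqrt3}\binom{2k-2}{k-1} +\sum_{j=1}^{\lfloor k/2\rfloor}\frac{(-1)^j\pi^{2j}B_{2j}}{(2j)!}\big(2^{2j-1}-1\big)\Big(1-\frac{3}{3^{2j}}\Big)\binom{2k-2j-1}{k-1}\\ &-\frac{2}{\sqrt3}\sum_{j=1}^{\lfloor (k-1)/2\rfloor}\Big(\frac\pi3\Big)^{2j+1}(-1)^j\binom{2k-2j-2}{k-1}\left(\frac{3j+1}{(2j+1)!}-3\sum_{\ell=1}^{j}\frac{6^{2\ell-1}B_{2\ell}}{(2j-2\ell+1)!\,(2\ell)!}\right)\Bigg). \end{aligned} $$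
   Context: $\mathrm{Exp}(\lambda)$ denotes the exponential distribution with rate $\lambda$ (density $\lambda e^{-\lambda x}$, $x\ge0$). The Bernoulli numbers $B_n$ are defined by $\frac{z}{e^z-1}=\sum_{n\ge0}\frac{B_n}{n!}z^n$ for $|z|<2\pi$. Empty sums are zero. *)

(* Defs.v *)
From HB Require Import structures.
From mathcomp Require Import all_boot all_order all_algebra.
From mathcomp Require Import all_classical all_reals all_analysis.
Set Implicit Arguments. Unset Strict Implicit. Unset Printing Implicit Defensive.
Import Order.TTheory GRing.Theory Num.Theory.
Import numFieldNormedType.Exports.
Local Open Scope classical_set_scope.
Local Open Scope ring_scope.

Definition bernoulli_gf {R : realType} (z : R) : R :=
  if z == 0 then 1 else z / (expR z - 1).

(* B_n = n-th derivative at 0 of z/(e^z-1), i.e. n! times its n-th Taylor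
   coefficient: exactly the definition z/(e^z-1) = sum_n B_n z^n / n!. *)
Definition bernoulli {R : realType} (n : nat) : R := derive1n n (@bernoulli_gf R) 0.

Definition mutually_independent {R : realType} {d : measure_display}
  {T : measurableType d} (P : probability T R) (X : nat -> T -> R) : Prop :=
  forall (s : seq nat) (B : nat -> set R),
    uniq s -> (forall i, i \in s -> measurable (B i)) ->
    P (\bigcap_(i in [set` s]) (X i @^-1` B i)) =
    (\prod_(i <- s) P (X i @^-1` B i))%E.

(* Main.v *)
(* Write P_n(q) = (1 - q)(1 - q^2)...(1 - q^n), so that max(0, X_1, ..., X_n)
   has distribution function P_n(e^-x).  Shanks' finite form of the pentagonal
   number theorem expresses 1 - P_n as the truncated pentagonal series up to an
   error at most sum_(s <= n) q^(sn + s(s+1)/2).  Integrating against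
   k x^(k-1) dx turns every q^e into k! / e^k, the error tends to 0, and by
   monotone convergence
     E(M^k) = - k! sum_(n <> 0) (-1)^n (2 / (n (3n - 1)))^k.
   With U = 1 / (3n) and V = - 1 / (3n - 1) one has UV = U + V and
   2 / (n (3n - 1)) = -6 UV; the partial fraction expansion of (UV)^k reduces
   the series to sums of (-1)^n (U^m + V^m).  These are values at pi (m even)
   and at pi / 3 (m odd) of the Fourier series of the Bernoulli polynomials. *)

Require Import Defs.
From HB Require Import structures.
From mathcomp Require Import all_boot all_order all_algebra.
From mathcomp Require Import all_classical all_reals all_analysis.
From mathcomp Require Import measurable_realfun.
From mathcomp Require Import ring lra zify.
Import Order.TTheory GRing.Theory Num.Theory.
Import numFieldNormedType.Exports.
Local Open Scope classical_set_scope.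
Local Open Scope ring_scope.

(** * Bernoulli numbers as Taylor coefficients *)

(** The delicate order is m = 1: the sine series at pi / 3 converges only conditionally, and its
    error is not uniformly small near 0. The Dirichlet kernel yields a bound of order 1 / (N x)
    together with a uniform bound; these two make order 2 uniform, and higher orders follow by
    integration. Each error of order at least 2 vanishes somewhere on [0, pi], which fixes the
    constant of integration. The two angles come from residues modulo 3. Up to sign, V runs through
    the reciprocals of the integers prime to 3. For even m these are all integers with the multiples
    of 3 removed, with signs given by cos (r pi). For odd m the powers of U cancel between n and -n,
    while sin (r pi / 3) vanishes on multiples of 3 and has the required signs elsewhere. The
    excluded index n = 0 would give V = 1; these missing ones add up to the leading binomial
    coefficient. The truncated pentagonal series has terms of both signs. Moving the negative ones
    across keeps all integrands nonnegative, so monotonicity of the integral suffices and finiteness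
    of the truncated moments comes with it. *)

Lemma is_derive_derive1 {R : realType} (f g : R -> R) :
  (forall x, is_derive x (1 : R) f (g x)) -> derive1 f = g.
Proof. by move=> fg; apply/funext => x; rewrite derive1E derive_val. Qed.

(** [derive1n] is total, so its rules for sums, products and scalings hold only where the
    derivatives exist; this predicate carries that existence on the whole line, up to order n. *)
Fixpoint smooth {R : realType} (n : nat) (f : R -> R) : Prop :=
  if n is n'.+1 then (forall x, derivable f x 1) /\ smooth n' (derive1 f) else True.

Section smooth.
Arguments smooth : simpl never.
Context {R : realType}.
Implicit Types (f g : R -> R) (n : nat).

Lemma derivable_derive1 f x : derivable f x 1 -> is_derive x (1 : R) f ((derive1 f) x).
Proof. by move=> df; rewrite derive1E; apply: DeriveDef. Qed.

Lemma smooth_is_derive n f g :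
  (forall x, is_derive x (1 : R) f (g x)) -> smooth n g -> smooth n.+1 f.
Proof.
move=> fg sg; split; first by move=> x; have := fg x; case.
by rewrite (is_derive_derive1 _ _ fg).
Qed.

Lemma smoothW n f : smooth n.+1 f -> smooth n f.
Proof. by elim: n f => [//|n IH] f [df sf]; split=> //; exact: IH. Qed.

Lemma is_derive_cst1 (c x : R) : is_derive x (1 : R) (fun=> c) 0.
Proof. exact: is_derive_cst. Qed.

Lemma smooth_cst n (c : R) : smooth n (fun=> c).
Proof.
elim: n c => [//|n IH] c; exact: smooth_is_derive (IH 0).
Qed.

Lemma smooth_id n : smooth n (@idfun R).
Proof.
case: n => [//|n]; exact: smooth_is_derive (smooth_cst n 1).
Qed.

Lemma is_deriveDf f g (df dg x : R) : is_derive x (1 : R) f df ->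
  is_derive x (1 : R) g dg -> is_derive x (1 : R) (fun y => f y + g y) (df + dg).
Proof. by move=> Df Dg; exact: is_deriveD. Qed.

Lemma is_deriveMf f g (df dg x : R) : is_derive x (1 : R) f df ->
  is_derive x (1 : R) g dg ->
  is_derive x (1 : R) (fun y => f y * g y) (df * g x + f x * dg).
Proof.
move=> Df Dg; apply: (@is_derive_eq _ _ _ (f * g) x 1 _ _ (is_deriveM Df Dg)).
by rewrite /GRing.scale /= addrC; congr (_ + _); exact: mulrC.
Qed.

Lemma smoothD n f g : smooth n f -> smooth n g -> smooth n (fun x => f x + g x).
Proof.
elim: n f g => [//|n IH] f g [df sf] [dg sg].
apply: smooth_is_derive (IH _ _ sf sg) => x.
by apply: is_deriveDf; exact: derivable_derive1.
Qed.

Lemma smoothM n f g : smooth n f -> smooth n g -> smooth n (fun x => f x * g x).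
Proof.
elim: n f g => [//|n IH] f g sf sg; have [df sf'] := sf; have [dg sg'] := sg.
apply: smooth_is_derive
  (smoothD _ _ _ (IH _ _ sf' (smoothW _ _ sg)) (IH _ _ (smoothW _ _ sf) sg')) => x.
by apply: is_deriveMf; exact: derivable_derive1.
Qed.

Lemma is_derive_comp_scale f (c df x : R) : is_derive (c * x) (1 : R) f df ->
  is_derive x (1 : R) (fun y => f (c * y)) (c * df).
Proof.
move=> Df.
have Dc : is_derive x (1 : R) (fun y => c * y) c.
  exact: is_derive_eq (is_deriveZ c (is_derive_id x 1)) (mulr1 _).
exact: is_derive_eq (@is_derive1_comp _ f (fun y => c * y) _ _ _ Df Dc) (mulrC _ _).
Qed.

Lemma smooth_scale n f (c : R) : smooth n f -> smooth n (fun x => f (c * x)).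
Proof.
elim: n f => [//|n IH] f [df sf].
apply: smooth_is_derive (smoothM _ _ _ (smooth_cst n c) (IH _ sf)) => x.
by apply: is_derive_comp_scale; exact: derivable_derive1.
Qed.

Lemma smooth_expR n : smooth n (@expR R).
Proof.
by elim: n => [//|n IH]; exact: smooth_is_derive IH.
Qed.

Lemma smoothV n f : (forall x, f x != 0) -> smooth n f ->
  smooth n (fun x => (f x)^-1).
Proof.
move=> f0; elim: n => [//|n IH] sf; have [df sf'] := sf.
have sV := IH (smoothW _ _ sf).
apply: smooth_is_derive (smoothM _ _ _ (smoothM _ _ _ (smooth_cst n (-1)) sf')
  (smoothM _ _ _ sV sV)) => x.
apply: is_derive_eq (is_deriveV (f0 x) (derivable_derive1 _ _ (df x))) _.
by rewrite /GRing.scale /= expr2 invfM; ring.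
Qed.

Lemma derive1nDf n f g (x : R) : smooth n f -> smooth n g ->
  derive1n n (fun y => f y + g y) x = derive1n n f x + derive1n n g x.
Proof.
elim: n f g => [//|n IH] f g [df sf] [dg sg]; rewrite !derive1Sn -IH//.
congr (derive1n n _ x); apply: is_derive_derive1 => y.
by apply: is_deriveDf; exact: derivable_derive1.
Qed.

(** Inductive step of the Leibniz formula, with the derivatives abstracted to arbitrary sequences so
    that only Pascal's rule remains. *)
Lemma sum_pascal (F G : R ^nat) n :
  \sum_(i < n.+1) 'C(n, i)%:R * F i.+1 * G (n - i)%N +
  \sum_(i < n.+1) 'C(n, i)%:R * F i * G (n - i).+1 =
  \sum_(i < n.+2) 'C(n.+1, i)%:R * F i * G (n.+1 - i)%N.
Proof.
rewrite [RHS]big_ord_recl bin0 mul1r subn0.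
under [in RHS]eq_bigr => i _ do
  rewrite /= /bump leq0n add1n binS natrD !mulrDl subSS.
rewrite big_split /= [RHS]addrA [RHS]addrC; congr (_ + _).
rewrite big_ord_recl bin0 mul1r subn0; congr (_ + _).
rewrite [RHS]big_ord_recr /= bin_small// !mul0r addr0.
by apply: eq_bigr => i _; rewrite /= /bump leq0n add1n -subSn.
Qed.

Lemma derive1nM n f g (x : R) : smooth n f -> smooth n g ->
  derive1n n (fun y => f y * g y) x =
  \sum_(i < n.+1) 'C(n, i)%:R * derive1n i f x * derive1n (n - i) g x.
Proof.
elim: n f g => [|n IH] f g sf sg.
  by rewrite big_ord1 /= bin0 mul1r.
have [df sf'] := sf; have [dg sg'] := sg.
have sfn := smoothW _ _ sf; have sgn := smoothW _ _ sg.
rewrite derive1Sn (_ : derive1 (fun y => f y * g y) =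
    (fun y => (derive1 f) y * g y + f y * (derive1 g) y)); last first.
  apply: is_derive_derive1 => y.
  by apply: is_deriveMf; exact: derivable_derive1.
rewrite derive1nDf; [|exact: smoothM..].
rewrite !IH//.
under eq_bigr do rewrite -derive1Sn.
under [X in _ + X]eq_bigr do rewrite -derive1Sn.
exact: (sum_pascal (fun k => derive1n k f x) (fun k => derive1n k g x)).
Qed.

Lemma derive1nZ n f (c x : R) : smooth n f ->
  derive1n n (fun y => c * f y) x = c * derive1n n f x.
Proof.
elim: n f => [//|n IH] f [df sf]; rewrite !derive1Sn -IH//.
congr (derive1n n _ x); apply: is_derive_derive1 => y.
have := is_deriveMf _ _ _ _ _ (is_derive_cst1 c y) (derivable_derive1 _ _ (df y)).
by rewrite mul0r add0r.
Qed.

Lemma derive1n_scale n f (c x : R) : smooth n f ->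
  derive1n n (fun y => f (c * y)) x = c ^+ n * derive1n n f (c * x).
Proof.
elim: n f => [|n IH] f; first by rewrite mul1r.
move=> [df sf]; rewrite !derive1Sn exprS -mulrA -IH//.
rewrite -derive1nZ; last exact: smooth_scale.
congr (derive1n n _ x); apply: is_derive_derive1 => y.
by apply: is_derive_comp_scale; exact: derivable_derive1.
Qed.

Lemma derive1n_expR n : derive1n n (@expR R) = expR.
Proof.
elim: n => [//|n IH]; rewrite derive1nS IH.
by apply: is_derive_derive1 => x; exact: is_derive_expR.
Qed.

Lemma derive1n_cst n (c x : R) : derive1n n.+1 (fun=> c) x = 0.
Proof.
elim: n c => [|n IH] c; rewrite derive1Sn (_ : derive1 (fun=> c) = (fun=> 0 : R))//;
  by apply: is_derive_derive1 => y; exact: is_derive_cst1.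
Qed.

Lemma derive1n_id0 n : derive1n n (@idfun R) 0 = (n == 1%N)%:R.
Proof.
case: n => [//|n]; rewrite derive1Sn (_ : derive1 idfun = (fun=> 1 : R)); last first.
  by apply: is_derive_derive1 => x; exact: is_derive_id.
by case: n => [//|n]; exact: derive1n_cst.
Qed.

End smooth.

(** * Smoothness of the generating function, parity and duplication of Bernoulli numbers *)

Section bernoulli.
Context {R : realType}.
Implicit Types (c : R ^nat) (n : nat).

Lemma cvg_pseries_fact c (x : R) : (forall n, `|c n| <= (n`!%:R)^-1) ->
  cvgn (pseries c x).
Proof.
move=> hc; apply: normed_cvg; rewrite /normed_series_of /=.
apply: series_le_cvg (is_cvg_series_exp_coeff `|x|) => [n|n|n] //=.
  by rewrite /exp_coeff /= divr_ge0// exprn_ge0.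
by rewrite /exp_coeff /= normrM normrX mulrC ler_wpM2l// exprn_ge0.
Qed.

Lemma pseries_diffs_fact c : (forall n, `|c n| <= (n`!%:R)^-1) ->
  forall n, `|pseries_diffs c n| <= (n`!%:R)^-1.
Proof.
move=> hc n; rewrite /pseries_diffs normrM normr_nat.
have := hc n.+1; rewrite factS natrM invfM -ler_pdivlMl ?ltr0n//.
Qed.

(** The bound 1 / n! on the coefficients is stable under formal differentiation and forces
    convergence everywhere, so the induction never meets a radius of convergence. *)
Lemma smooth_pseries n c : (forall n, `|c n| <= (n`!%:R)^-1) ->
  smooth n (fun x => limn (pseries c x)).
Proof.
elim: n c => [//|n IH] c hc.
have hc1 := pseries_diffs_fact _ hc; have hc2 := pseries_diffs_fact _ hc1.
apply: smooth_is_derive (IH _ hc1) => x.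
apply: (@pseries_snd_diffs _ c (`|x| + 1)); [exact: cvg_pseries_fact..|].
by rewrite [ltRHS]ger0_norm ?ltrDl// addr_ge0.
Qed.

(** The entire function (e^x - 1) / x. It has no real zero, so its inverse is smooth and agrees with
    [bernoulli_gf] also at the removable singularity 0. *)
Let g (x : R) : R := limn (pseries (fun n => (n.+1`!%:R)^-1) x).

Let c_le n : `|(n.+1`!%:R)^-1 : R| <= (n`!%:R)^-1.
Proof.
rewrite ger0_norm ?invr_ge0// lef_pV2 ?posrE ?ltr0n ?fact_gt0//.
by rewrite ler_nat factS leq_pmull.
Qed.

Let gM (x : R) : x * g x = expR x - 1.
Proof.
have cg : cvgn (pseries (fun n => (n.+1`!%:R)^-1) x) by exact: cvg_pseries_fact c_le.
have h : x * pseries (fun n => (n.+1`!%:R)^-1) x n @[n --> \oo] --> x * g x.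
  by apply: cvgMr; exact: cg.
apply: cvg_unique h _ => //.
have : series (exp_coeff x) n @[n --> \oo] --> expR x.
  exact: is_cvg_series_exp_coeff.
rewrite -cvg_shiftS => h'.
rewrite (_ : (fun n => _) = fun n => series (exp_coeff x) n.+1 - 1).
  by apply: cvgB => //; exact: cvg_cst.
apply/funext => n; rewrite /pseries /series /= big_nat_recl//= /exp_coeff /=.
rewrite expr0 fact0 divr1 addrAC subrr add0r mulr_sumr.
by apply: eq_bigr => i _; rewrite exprS; ring.
Qed.

Let g0 : g 0 = 1.
Proof.
apply: cvg_lim => //; apply: cvg_near_cst; near=> n.
rewrite /pseries /series /=.
have -> : n = n.-1.+1 by rewrite prednK//; near: n; exact: nbhs_infty_gt.
rewrite big_nat_recl//= expr0 mulr1 invr1 big1 ?addr0// => i _.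
by rewrite expr0n /= mulr0.
Unshelve. all: by end_near. Qed.

Let g_neq0 x : g x != 0.
Proof.
have [->|x0] := eqVneq x 0; first by rewrite g0 oner_neq0.
apply/negP => /eqP gx0; have := gM x; rewrite gx0 mulr0 => /esym/eqP.
by rewrite subr_eq0 -expR0 => /eqP/expR_inj/eqP; exact/negP.
Qed.

Lemma smooth_bernoulli_gf n : smooth n (@bernoulli_gf R).
Proof.
rewrite (_ : bernoulli_gf = fun x => (g x)^-1).
  by apply: smoothV => //; exact: smooth_pseries c_le.
apply/funext => x; rewrite /bernoulli_gf; case: eqVneq => [->|x0].
  by rewrite g0 invr1.
by rewrite -gM invfM mulrA divff// mul1r.
Qed.

Lemma bernoulli0 : bernoulli 0 = 1 :> R.
Proof. by rewrite /bernoulli /= /bernoulli_gf eqxx. Qed.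

Let expR_neq1 (x : R) : x != 0 -> expR x - 1 != 0.
Proof. by move=> x0; rewrite -gM mulf_neq0. Qed.

(** With G the generating function, G(-x) = G(x) + x; the summand x only affects the first
    derivative at 0. *)
Lemma bernoulliN n : (-1) ^+ n * bernoulli n = bernoulli n + (n == 1%N)%:R :> R.
Proof.
have s := smooth_bernoulli_gf n.
rewrite /bernoulli -[in LHS](mulr0 (-1)) -derive1n_scale// -derive1n_id0.
rewrite -derive1nDf//; last exact: smooth_id.
congr (derive1n n _ 0); apply/funext => x; rewrite mulN1r /bernoulli_gf oppr_eq0.
case: eqVneq => [->|x0] /=; first by rewrite addr0.
have h1 := expR_neq1 _ x0; have e0 : expR x != 0 by rewrite gt_eqF ?expR_gt0.
by rewrite expRN /=; field; rewrite h1 e0 mulN1r -opprB oppr_eq0.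
Qed.

Lemma bernoulli_odd n : (1 < n)%N -> odd n -> bernoulli n = 0 :> R.
Proof.
move=> n1 on; have := bernoulliN n.
rewrite -signr_odd on expr1 gtn_eqF// addr0 => h; lra.
Qed.

Lemma bernoulli1 : bernoulli 1 = - 2^-1 :> R.
Proof. by have := bernoulliN 1; rewrite expr1 /= => h; lra. Qed.

(** Compare n-th derivatives at 0 in G(2x) e^x = 2 G(x) - G(2x), with G the generating function.
    Both sides are 2^n times the Bernoulli polynomial at 1/2, which is what the value of [bern_poly]
    at pi requires. *)
Lemma bernoulli_double n :
  \sum_(i < n.+1) 'C(n, i)%:R * 2 ^+ i * bernoulli i = (2 - 2 ^+ n) * bernoulli n :> R.
Proof.
have s := smooth_bernoulli_gf.
have s2 m : smooth m (fun x : R => bernoulli_gf (2 * x)) by exact: smooth_scale.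
transitivity (derive1n n (fun x : R => bernoulli_gf (2 * x) * expR x) 0).
  rewrite derive1nM//; last exact: smooth_expR.
  apply: eq_bigr => i _; rewrite derive1n_scale// mulr0 derive1n_expR expR0.
  by rewrite mulr1 mulrA.
transitivity (derive1n n (fun x : R => 2 * bernoulli_gf x + (-1) * bernoulli_gf (2 * x)) 0).
  congr (derive1n n _ 0); apply/funext => x; rewrite /bernoulli_gf mulf_eq0 pnatr_eq0 /=.
  case: eqVneq => [->|x0]; first by rewrite expR0; lra.
  have h1 := expR_neq1 _ x0; have h2 := expR_neq1 (2 * x) ltac:(by rewrite mulf_neq0).
  have e2 : expR (2 * x) = expR x * expR x by rewrite -expRD; congr expR; ring.
  rewrite e2 in h2 *; field; rewrite h1 h2 //.
rewrite derive1nDf; [|by apply: smoothM => //; exact: smooth_cst..].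
by rewrite !derive1nZ// derive1n_scale// mulr0 -/(bernoulli n); ring.
Qed.

End bernoulli.

(** * Fourier series of the Bernoulli polynomials *)

Section mean_value.
Context {R : realType}.
Implicit Types (f df : R -> R).

Lemma is_derive_within_continuous f df (a b : R) :
  (forall x, a <= x <= b -> is_derive x (1 : R) f (df x)) ->
  {within `[a, b], continuous f}.
Proof.
move=> fdf; apply: continuous_in_subspaceT => x; rewrite inE /= in_itv/= => xab.
apply: differentiable_continuous; apply/derivable1_diffP.
by have [] := fdf _ xab.
Qed.

Lemma mean_value f df (a b : R) : a <= b ->
  (forall x, a <= x <= b -> is_derive x (1 : R) f (df x)) ->
  exists2 c, a <= c <= b & f b - f a = df c * (b - a).
Proof.
move=> ab fdf; have [c cab fc] : exists2 c, c \in `[a, b]%R &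
    f b - f a = df c * (b - a).
  apply: MVT_segment => //; last exact: is_derive_within_continuous fdf.
  by move=> x; rewrite in_itv/= => /andP[ax xb]; apply: fdf; rewrite !ltW.
by exists c => //; rewrite in_itv in cab.
Qed.

Lemma mean_value_bound f df (a b K : R) : a <= b ->
  (forall x, a <= x <= b -> is_derive x (1 : R) f (df x)) ->
  (forall x, a <= x <= b -> `|df x| <= K) ->
  `|f b - f a| <= K * (b - a).
Proof.
move=> ab fdf Kdf; have [c cab ->] := mean_value _ _ _ _ ab fdf.
by rewrite normrM [`|b - a|]ger0_norm ?subr_ge0// ler_wpM2r ?subr_ge0// Kdf.
Qed.

Lemma mean_value_zero f df (a b : R) : a < b ->
  (forall x, a <= x <= b -> is_derive x (1 : R) f (df x)) -> f a = f b ->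
  exists2 c, a <= c <= b & df c = 0.
Proof.
move=> ab fdf fab; have [c cab] := mean_value _ _ _ _ (ltW ab) fdf.
rewrite fab subrr => /esym/eqP; rewrite mulf_eq0 subr_eq0 (gt_eqF ab) orbF => /eqP.
by exists c.
Qed.

End mean_value.

Section derivative_rules.
Context {R : realType}.
Implicit Types (f : R -> R) (x c : R).

Lemma is_deriveZf f c x df : is_derive x (1 : R) f df ->
  is_derive x (1 : R) (fun y => c * f y) (c * df).
Proof. by move=> Df; exact: is_deriveZ. Qed.

Lemma is_derive_sumf (I : eqType) (r : seq I) (f df : I -> R -> R) x :
  (forall i, i \in r -> is_derive x (1 : R) (f i) (df i x)) ->
  is_derive x (1 : R) (fun y => \sum_(i <- r) f i y) (\sum_(i <- r) df i x).
Proof.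
elim: r => [|i r IH] fdf.
  rewrite big_nil (_ : (fun _ => _) = fun=> 0); first exact: is_derive_cst1.
  by apply/funext => y; rewrite big_nil.
rewrite big_cons (_ : (fun _ => _) = fun y => f i y + \sum_(i <- r) f i y).
  apply: is_deriveDf; first by apply: fdf; rewrite mem_head.
  by apply: IH => j jr; apply: fdf; rewrite inE jr orbT.
by apply/funext => y; rewrite big_cons.
Qed.

Lemma is_derive_exprS n x :
  is_derive x (1 : R) (fun y : R => y ^+ n.+1) (n.+1%:R * x ^+ n).
Proof.
have := is_deriveX n.+1 (is_derive_id x 1); rewrite exprfctE => D.
by apply: is_derive_eq D _; rewrite /GRing.scale /= mulr1 -mulr_natl.
Qed.

Lemma is_derive_divided_power n x :
  is_derive x (1 : R) (fun y => y ^+ n.+1 / n.+1`!%:R) (x ^+ n / n`!%:R).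
Proof.
rewrite (_ : (fun _ => _) = fun y => (n.+1`!%:R)^-1 * y ^+ n.+1); last first.
  by apply/funext => y; rewrite mulrC.
apply: is_derive_eq (is_deriveZf _ _ _ _ (is_derive_exprS n x)) _.
by rewrite factS natrM invfM mulrC mulrACA divff ?mul1r ?pnatr_eq0.
Qed.

End derivative_rules.

Section bernoulli_fourier.
Context {R : realType}.
Implicit Types (m n N : nat) (x y : R).

(* [trig m] is an [m]-fold primitive of [-cos]: the cycle -cos, -sin, cos, sin. *)
Definition trig m y : R := (-1) ^+ (m./2).+1 * (if odd m then sin y else cos y).

Definition trig_sum m N x : R := \sum_(1 <= n < N.+1) trig m (n%:R * x) / n%:R ^+ m.

(* (2 pi)^m B_m(x / 2pi) / m!, a scaling that makes [bern_poly m] the derivative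
   of [bern_poly m.+1]. *)
Definition bern_poly m x : R :=
  \sum_(0 <= i < m.+1) (2 * pi) ^+ i * bernoulli i / i`!%:R * (x ^+ (m - i) / (m - i)`!%:R).

(** Differentiation lowers the order by one and preserves this form, so each order can be estimated
    from the one below by the mean value theorem. *)
Definition trig_err m N x : R := trig_sum m N x - bern_poly m x / 2.

Lemma is_derive_trig m y : is_derive y (1 : R) (trig m.+1) (trig m y).
Proof.
rewrite (_ : trig m.+1 = fun z =>
  (-1) ^+ (odd m + m./2).+1 * (if odd m then cos z else sin z)); last first.
  by apply/funext => z; rewrite /trig /= uphalf_half; case: (odd m).
rewrite /trig; case: (odd m) => /=; last exact: is_deriveZf.
apply: is_derive_eq (is_deriveZf _ _ _ _ (is_derive_cos y)) _.
by rewrite add1n exprS mulN1r mulrNN.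
Qed.

Lemma is_derive_trig_sum m N x : is_derive x (1 : R) (trig_sum m.+1 N) (trig_sum m N x).
Proof.
apply: (is_derive_sumf _ _ (fun n y => trig m.+1 (n%:R * y) / n%:R ^+ m.+1)
  (fun n y => trig m (n%:R * y) / n%:R ^+ m)) => n.
rewrite mem_index_iota => /andP[n0 _].
rewrite (_ : (fun _ => _) = fun y => (n%:R ^+ m.+1)^-1 * trig m.+1 (n%:R * y)); last first.
  by apply/funext => y; rewrite mulrC.
apply: is_derive_eq.
  by apply: is_deriveZf; apply: is_derive_comp_scale; exact: is_derive_trig.
by rewrite exprS invfM; field; rewrite !pnatr_eq0 -!lt0n n0 expf_eq0 pnatr_eq0 (gtn_eqF n0) andbF.
Qed.

Lemma is_derive_bern_poly m x : is_derive x (1 : R) (bern_poly m.+1) (bern_poly m x).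
Proof.
rewrite (_ : bern_poly m.+1 = fun y => \sum_(0 <= i < m.+1)
    ((2 * pi) ^+ i * bernoulli i / i`!%:R * (y ^+ (m.+1 - i) / (m.+1 - i)`!%:R)) +
    (2 * pi) ^+ m.+1 * bernoulli m.+1 / m.+1`!%:R); last first.
  apply/funext => y; rewrite /bern_poly big_nat_recr//= subnn expr0 fact0.
  by rewrite divr1 mulr1.
rewrite -[bern_poly m x]addr0; apply: is_deriveDf (is_derive_cst1 _ _).
apply: (is_derive_sumf _ _ (fun i y => (2 * pi) ^+ i * bernoulli i / i`!%:R *
    (y ^+ (m.+1 - i) / (m.+1 - i)`!%:R))
  (fun i y => (2 * pi) ^+ i * bernoulli i / i`!%:R *
    (y ^+ (m - i) / (m - i)`!%:R))) => i.
rewrite mem_index_iota => /andP[_ im].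
by apply: is_deriveZf; rewrite subSn//; exact: is_derive_divided_power.
Qed.

Lemma is_derive_trig_err m N x : is_derive x (1 : R) (trig_err m.+1 N) (trig_err m N x).
Proof.
have trig_errE k y : trig_err k N y = trig_sum k N y + - 2^-1 * bern_poly k y.
  by rewrite mulNr mulrC.
rewrite trig_errE (_ : trig_err m.+1 N = fun y =>
  trig_sum m.+1 N y + - 2^-1 * bern_poly m.+1 y); last exact/funext/trig_errE.
apply: is_deriveDf; first exact: is_derive_trig_sum.
by apply: is_deriveZf; exact: is_derive_bern_poly.
Qed.

Lemma bern_poly0 m : bern_poly m 0 = (2 * pi) ^+ m * bernoulli m / m`!%:R.
Proof.
rewrite /bern_poly big_nat_recr//= subnn expr0 fact0 divr1 mulr1 big_nat.
rewrite big1 ?add0r// => i /andP[_ im].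
by rewrite expr0n subn_eq0 leqNgt im mul0r mulr0.
Qed.

Lemma bern_poly_pi m : bern_poly m pi = pi ^+ m * (2 - 2 ^+ m) * bernoulli m / m`!%:R.
Proof.
rewrite -[_ * _ * bernoulli m]mulrA -bernoulli_double mulr_sumr mulr_suml.
rewrite /bern_poly big_mkord; apply: eq_bigr => i _.
have im : (i <= m)%N by rewrite -ltnS.
have fact0 k : k`!%:R != 0 :> R by rewrite pnatr_eq0 -lt0n fact_gt0.
have := bin_fact im; rewrite -[in pi ^+ m](subnKC im).
move/(congr1 (GRing.natmul (1 : R))); rewrite !natrM exprD exprMn => <-.
by field; rewrite !fact0 pnatr_eq0 -lt0n bin_gt0 im.
Qed.

Lemma sin_natpi n : sin (n%:R * pi) = 0 :> R.
Proof.
elim: n => [|n IH]; first by rewrite mul0r sin0.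
by rewrite -natr1 mulrDl mul1r sinDpi IH oppr0.
Qed.

Lemma cos_natpi n : cos (n%:R * pi) = (-1) ^+ n :> R.
Proof.
elim: n => [|n IH]; first by rewrite mul0r cos0.
by rewrite -natr1 mulrDl mul1r cosDpi IH exprS mulN1r.
Qed.

(** All sines vanish at 0, and so does the Bernoulli number of odd order above 1. Order 1 is
    excluded because of B_1 = -1/2. *)
Lemma trig_err0 m N : (1 < m)%N -> odd m -> trig_err m N 0 = 0.
Proof.
move=> m1 om; rewrite /trig_err bern_poly0 bernoulli_odd// mulr0 !mul0r subr0.
rewrite /trig_sum big1 // => n _.
by rewrite mulr0 /trig om sin0 mulr0 mul0r.
Qed.

(** Unlike at 0, order 1 is included: the factor 2 - 2^m from the duplication formula vanishes at m
    = 1. *)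
Lemma trig_err_pi m N : odd m -> trig_err m N pi = 0.
Proof.
move=> om; rewrite /trig_err bern_poly_pi.
rewrite /trig_sum big1 => [|n _]; last first.
  by rewrite /trig om sin_natpi mulr0 mul0r.
have [->|m1] := eqVneq m 1%N.
  by rewrite bernoulli1 !expr1 subrr mulr0 !mul0r subrr.
by rewrite bernoulli_odd ?mulr0 ?mul0r ?subrr//; case: m m1 om => [|[|]].
Qed.

(** Odd orders vanish at 0. For even m, the error of order m + 1 vanishes at both 0 and pi, and
    Rolle's theorem gives a zero of its derivative. This replaces any separate evaluation of the
    series at a point. *)
Lemma trig_err_zero m N : (1 < m)%N -> exists2 x, 0 <= x <= pi & trig_err m N x = 0.
Proof.
move=> m1; case: (boolP (odd m)) => om.
  by exists 0; [rewrite lexx pi_ge0|rewrite trig_err0].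
apply: (mean_value_zero (trig_err m.+1 N)) (pi_gt0 R) _ _ => [x _|].
  exact: is_derive_trig_err.
by rewrite trig_err0 ?trig_err_pi//= ltnW.
Qed.

(** [trig_err 0 N x] is minus the Dirichlet kernel 1/2 + cos x + ... + cos (N x). *)
Lemma dirichlet_kernel N x :
  2 * sin (x / 2) * trig_err 0 N x = - sin ((N%:R + 2^-1) * x).
Proof.
rewrite /trig_err [bern_poly 0 x](_ : _ = 1); last first.
  by rewrite /bern_poly big_nat1 /= bernoulli0 !expr0 fact0 !divr1 !mulr1.
elim: N => [|N IH].
  by rewrite /trig_sum big_geq// !add0r mulrN [_^-1 * x]mulrC; field.
rewrite /trig_sum big_nat_recr//= -/(trig_sum 0 N x) expr0 divr1 addrAC mulrDr IH.
rewrite /trig /= expr1 mulN1r.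
have -> : (N%:R + 2^-1) * x = N.+1%:R * x - x / 2 by rewrite -natr1; field.
have -> : (N.+1%:R + 2^-1) * x = N.+1%:R * x + x / 2 by field.
by rewrite sinB sinD; ring.
Qed.

(** With y = x / 4, sin (2y) = 2 sin y cos y and sin y >= y cos y, while 2 cos^2 y >= 1 because cos
    (2y) >= 0. *)
Lemma sin_half_ge x : 0 <= x <= pi -> x / 4 <= sin (x / 2).
Proof.
move=> /andP[x0 xpi]; set y := x / 4.
have y0 : 0 <= y by rewrite /y divr_ge0.
have ypi : y *+ 2 <= pi / 2 by rewrite /y -mulr_natr; lra.
have pi0 := pi_gt0 R.
have -> : x / 2 = y *+ 2 by rewrite /y -mulr_natr; field.
have cy2 : 0 <= cos (y *+ 2).
  by rewrite cos_ge0_pihalf//; apply/andP; split; rewrite -mulr_natr in ypi *; lra.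
have cy : 0 <= cos y.
  by rewrite cos_ge0_pihalf//; apply/andP; split; rewrite -mulr_natr in ypi *; lra.
rewrite cos_mulr2n -mulr_natr in cy2; rewrite sin_mulr2n -mulr_natr.
have [c /andP[c0 cley]] := mean_value (@sin R) (@cos R) 0 y y0 (fun z _ => is_derive_sin z).
rewrite sin0 !subr0 => ->.
have cyc : cos y <= cos c.
  rewrite leNgt ltr_cos ?in_itv /= -?leNgt// ?y0 ?c0 /=; rewrite -mulr_natr in ypi; lra.
have : cos y * cos y <= cos y * cos c by rewrite ler_wpM2l.
rewrite expr2 in cy2; move=> h; rewrite mulrA -mulrA mulrC -mulrA.
rewrite -[leLHS]mulr1 ler_wpM2l//; lra.
Qed.

(** Integration by parts of the Dirichlet kernel from x to pi, where the error vanishes. The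
    boundary term and the remaining integral are each at most 1 / sin (x / 2) <= 4 / x. *)
Lemma trig_err1_bound N x : 0 < x <= pi ->
  `|trig_err 1 N x| <= 4 / ((N%:R + 2^-1) * x).
Proof.
move=> /andP[x0 xpi]; set l := N%:R + 2^-1.
have l0 : 0 < l by rewrite /l ltr_wpDl.
have pi0 := pi_gt0 R.
have s_gt0 y : x <= y <= pi -> 0 < sin (y / 2).
  by move=> /andP[xy ypi]; rewrite sin_gt0_pi//; apply/andP; split; lra.
have c_ge0 y : x <= y <= pi -> 0 <= cos (y / 2).
  by move=> /andP[xy ypi]; rewrite cos_ge0_pihalf//; apply/andP; split; lra.
have D2 y : is_derive y (1 : R) (fun z : R => z / 2) 2^-1.
  rewrite (_ : (fun z => _) = fun z => 2^-1 * z); last by apply/funext => z; rewrite mulrC.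
  exact: is_derive_eq (is_deriveZf _ _ _ _ (is_derive_id y 1)) (mulr1 _).
have Ds y : is_derive y (1 : R) (fun z : R => sin (z / 2)) (cos (y / 2) / 2).
  exact: (@is_derive1_comp _ sin (fun z => z / 2) y _ _ (is_derive_sin _) (D2 y)).
have Dc y : is_derive y (1 : R) (fun z : R => cos (l * z)) (l * - sin (l * y)).
  by apply: is_derive_comp_scale; exact: is_derive_cos.
have Dv y : x <= y <= pi -> is_derive y (1 : R) (fun z : R => (sin (z / 2))^-1)
    (- (cos (y / 2) / 2) / (sin (y / 2)) ^+ 2).
  move=> /s_gt0 sy; apply: is_derive_eq (is_deriveV (lt0r_neq0 sy) (Ds y)) _.
  by rewrite /GRing.scale /= mulrC mulNr mulrN.
(* [w] subtracts the boundary term of the integration by parts. Its derivative no longer contains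
   the factor l, and cos (l pi) = 0 makes it vanish at pi. *)
pose w z := 2 * l * trig_err 1 N z - cos (l * z) * (sin (z / 2))^-1.
have wpi : w pi = 0.
  rewrite /w trig_err_pi// mulr0 sub0r /l mulrDl cosD sin_natpi mul0r subr0.
  by rewrite [2^-1 * _]mulrC cos_pihalf mulr0 mul0r oppr0.
have Dw y : x <= y <= pi -> is_derive y (1 : R) w
    (cos (l * y) * (cos (y / 2) / 2) / (sin (y / 2)) ^+ 2).
  move=> xy; have sy := s_gt0 _ xy.
  rewrite (_ : w = fun z => 2 * l * trig_err 1 N z + -1 * (cos (l * z) * (sin (z / 2))^-1));
    last by apply/funext => z; rewrite mulN1r.
  apply: is_derive_eq (is_deriveDf _ _ _ _ _
    (is_deriveZf _ _ _ _ (is_derive_trig_err 0 N y))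
    (is_deriveZf _ _ _ _ (is_deriveMf _ _ _ _ _ (Dc y) (Dv y xy)))) _.
  have := dirichlet_kernel N y; rewrite -/l => K.
  have -> : trig_err 0 N y = - sin (l * y) / (2 * sin (y / 2)).
    by rewrite -K mulrAC divff ?mul1r// mulf_neq0// gt_eqF.
  by field; rewrite gt_eqF.
(* The derivative of [w] is dominated in absolute value by minus that of 1 / sin (z / 2), so 1 / sin
   (z / 2) - e w is nonincreasing for e = 1 and e = -1; comparing x with pi bounds [w x] on both
   sides. *)
have bound e : `|e| = 1 -> e * w x <= (sin (x / 2))^-1.
  move=> e1.
  have [y xy] := mean_value (fun z => (sin (z / 2))^-1 + - e * w z) _ x pi xpi
    (fun y xy => is_deriveDf _ _ _ _ _ (Dv y xy) (is_deriveZf _ (- e) _ _ (Dw y xy))).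
  rewrite wpi mulr0 addr0 sin_pihalf invr1 => h.
  have : - (cos (y / 2) / 2) / sin (y / 2) ^+ 2 +
      - e * (cos (l * y) * (cos (y / 2) / 2) / sin (y / 2) ^+ 2) <= 0.
    rewrite -subr_ge0 sub0r (_ : - _ =
      (1 + e * cos (l * y)) * (cos (y / 2) / 2 / sin (y / 2) ^+ 2)); last by ring.
    rewrite mulr_ge0// ?divr_ge0 ?sqr_ge0 ?c_ge0//.
    have : `|e * cos (l * y)| <= 1 by rewrite normrM e1 mul1r cos_max.
    by rewrite ler_norml => /andP[+ _]; lra.
  move=> K0; have : 1 - ((sin (x / 2))^-1 + - e * w x) <= 0.
    by rewrite h mulr_le0_ge0// subr_ge0.
  by lra.
have {}bound : `|w x| <= (sin (x / 2))^-1.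
  rewrite ler_norml; have := bound 1 (normr1 _); rewrite mul1r => ->.
  by have := bound (-1) (normrN1 _); rewrite mulN1r lerNl => ->.
have sx : 0 < sin (x / 2) by apply: s_gt0; rewrite lexx.
have hx : (sin (x / 2))^-1 <= 4 / x.
  rewrite -[4 / x]invf_div lef_pV2 ?posrE ?divr_gt0//.
  by apply: sin_half_ge; rewrite ltW.
have bound2 : `|2 * l * trig_err 1 N x| <= 8 / x.
  rewrite -[_ * _](subrK (cos (l * x) * (sin (x / 2))^-1)).
  apply: (le_trans (ler_normD _ _)).
  have : `|cos (l * x) * (sin (x / 2))^-1| <= 4 / x.
    rewrite normrM [`|_^-1|]ger0_norm; last by rewrite invr_ge0 ltW.
    apply: (@le_trans _ _ (1 * (sin (x / 2))^-1)); last by rewrite mul1r.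
    by rewrite ler_wpM2r ?cos_max// invr_ge0 ltW.
  rewrite -/(w x); move: bound hx; set a := `|w x|; set b := `|_ * _|; lra.
rewrite normrM [`|2 * l|]ger0_norm in bound2; last by rewrite mulr_ge0// ltW.
have E (a b : R) : 0 < a -> 0 < b -> 4 / (a * b) = (2 * a)^-1 * (8 / b).
  by move=> a0 b0; field; rewrite !gt_eqF.
by rewrite E// ler_pdivlMl ?mulr_gt0.
Qed.

Lemma norm_sin_le x : 0 <= x -> `|sin x| <= x.
Proof.
move=> x0; have := mean_value_bound (@sin R) (@cos R) 0 x 1 x0
  (fun y _ => is_derive_sin y) (fun y _ => cos_max y).
by rewrite sin0 !subr0 mul1r.
Qed.

(** If l x >= 1 the previous bound is at most 4. Otherwise |sin (n x)| <= n x bounds the sum by N x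
    <= 1, and the polynomial part is at most pi / 2 < 2. *)
Lemma trig_err1_le4 N x : 0 <= x <= pi -> `|trig_err 1 N x| <= 4.
Proof.
move=> /andP[x0 xpi]; pose l : R := N%:R + 2^-1.
have l0 : 0 < l by rewrite /l ltr_wpDl.
have [xl|xl] := leP 1 (l * x).
  have {}x0 : 0 < x.
    by rewrite lt_neqAle x0 andbT; apply/eqP => x00; rewrite -x00 mulr0 in xl; lra.
  apply: le_trans (trig_err1_bound N x _) _; first by rewrite x0.
  by rewrite -/l ler_pdivrMr ?mulr_gt0// ler_peMr.
have pi2 := @pihalf_lt2 R; have pi0 := pi_gt0 R.
have bp : bern_poly 1 x = x - pi.
  rewrite /bern_poly big_nat_recr//= big_nat1 /= bernoulli0 bernoulli1.
  by rewrite !expr0 !expr1 fact0 (_ : 1`! = 1%N)// !divr1; field.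
have S1 : `|trig_sum 1 N x| <= 1.
  apply: (@le_trans _ _ (\sum_(1 <= n < N.+1) x)).
    apply: le_trans (ler_norm_sum _ _ _) _; apply: ler_sum_nat => n /andP[n0 _].
    rewrite /trig /= expr1 expr1 mulN1r normrM normrN normfV [`|n%:R|]ger0_norm//.
    rewrite ler_pdivrMr ?ltr0n// mulrC; apply: norm_sin_le.
    by rewrite mulr_ge0.
  rewrite sumr_const_nat subSS subn0 -mulr_natl; apply: le_trans (ltW xl).
  by rewrite ler_wpM2r// /l lerDl.
rewrite /trig_err bp; apply: le_trans (ler_normB _ _) _.
have : `|(x - pi) / 2| <= 2 by rewrite ler_norml; apply/andP; split; lra.
by move: S1; set a := `|_|; set b := `|_|; lra.
Qed.

Definition unif_small (u : nat -> R -> R) := forall e, 0 < e -> exists N0,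
  forall N x, (N0 <= N)%N -> 0 <= x <= pi -> `|u N x| <= e.

(** The error of order 1 stays away from 0 at the origin, but it is bounded there and uniformly
    small away from it, which is enough after one integration. *)
Lemma trig_err2_unif : unif_small (trig_err 2).
Proof.
move=> e e0; have pi0 := pi_gt0 R.
(* On [0, de] the bound 4 on the derivative gives an oscillation of at most 4 de <= e / 4. On
   [de, pi] the choice of [N0] makes the derivative at most e / (4 pi), hence again at most e /
   4. *)
pose de := Num.min pi (e / 16).
have de0 : 0 < de by rewrite lt_min pi0 divr_gt0.
have [dpi de16] : de <= pi /\ de <= e / 16 by rewrite !ge_min !lexx orbT.
have [N0 hN0] : exists N0, 16 * pi / (de * e) < N0%:R.
  by exists (Num.truncn (16 * pi / (de * e))).+1; exact: truncnS_gt.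
exists N0 => N x N0N x0pi.
have D := is_derive_trig_err 1 N.
have h0 y : 0 <= y <= pi -> `|trig_err 2 N y - trig_err 2 N 0| <= e / 2.
  move=> /andP[y0 ypi].
  have small z : 0 <= z <= de -> `|trig_err 2 N z - trig_err 2 N 0| <= e / 4.
    move=> /andP[z0 zde].
    have := mean_value_bound _ _ 0 z 4 z0 (fun z _ => D z).
    move=> /(_ _)/le_trans; apply; last by rewrite subr0; lra.
    move=> t /andP[t0 tz]; apply: trig_err1_le4; rewrite t0/=; lra.
  have [yde|dey] := leP y de.
    by apply: le_trans (small y _) _; [rewrite y0|lra].
  rewrite -[_ - _](subrKA (trig_err 2 N de)).
  apply: le_trans (ler_normD _ _) _.
  have := small de; rewrite lexx (ltW de0) => /(_ isT).
  have : `|trig_err 2 N y - trig_err 2 N de| <= e / 4.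
    have := mean_value_bound _ _ de y (e / (4 * pi)) (ltW dey) (fun z _ => D z).
    move=> /(_ _)/le_trans; apply; last first.
      rewrite mulrAC ler_pdivrMr ?mulr_gt0//.
      have : e * (y - de) <= e * pi by rewrite ler_wpM2l//; lra.
      by lra.
    move=> t /andP[dt ty].
    have t0 : 0 < t by lra.
    apply: le_trans (trig_err1_bound N t _) _; first by rewrite t0; lra.
    rewrite ler_pdivrMr; last by rewrite mulr_gt0// ltr_wpDl.
    rewrite ltr_pdivrMr ?mulr_gt0// in hN0.
    rewrite mulrAC ler_pdivlMr ?mulr_gt0//.
    have N0R : N0%:R <= N%:R :> R by rewrite ler_nat.
    have : N0%:R * (de * e) <= (N%:R + 2^-1) * (t * e).
      have de_e : 0 <= de * e by rewrite mulr_ge0// ltW.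
      apply: ler_pM => //; first by lra.
      by apply: ler_pM => //; exact: ltW.
    by lra.
  by move=> + +; set a := `|_|; set b := `|_|; lra.
(* A zero turns the control of differences into control of the error itself: e / 2 for its value at
   0, and e / 2 for the distance to that value. *)
have [z z0pi z0] := trig_err_zero 2 N isT.
have := h0 _ z0pi; rewrite z0 sub0r normrN => h1.
rewrite -[trig_err 2 N x](subrK (trig_err 2 N 0)).
apply: le_trans (ler_normD _ _) _.
by have := h0 _ x0pi; move: h1; set a := `|_|; set b := `|_|; lra.
Qed.

Lemma trig_err_unif m : (1 < m)%N -> unif_small (trig_err m).
Proof.
elim: m => [//|m IH]; rewrite ltnS leq_eqVlt => /predU1P[<-|m1].
  exact: trig_err2_unif.
have pi0 := pi_gt0 R.
move=> e e0; have [|N0 hN0] := IH m1 (e / pi); first by rewrite divr_gt0.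
exists N0 => N x N0N /andP[x0 xpi].
have [z /andP[z0 zpi] ez] := trig_err_zero m.+1 N (ltnW m1).
have main a b : 0 <= a -> a <= b -> b <= pi ->
    `|trig_err m.+1 N b - trig_err m.+1 N a| <= e.
  move=> a0 ab bpi.
  have := mean_value_bound _ _ a b (e / pi) ab (fun z _ => is_derive_trig_err m N z).
  move=> /(_ _)/le_trans; apply; last first.
    by rewrite mulrAC ler_pdivrMr// ler_wpM2l ?(ltW e0)//; lra.
  by move=> t /andP[at_ tb]; apply: hN0 => //; apply/andP; split; lra.
have [zx|xz] := leP z x; first by have := main _ _ z0 zx xpi; rewrite ez subr0.
by have := main _ _ x0 (ltW xz) zpi; rewrite ez sub0r normrN.
Qed.

Lemma cvg_trig_sum m x : (1 < m)%N -> 0 <= x <= pi ->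
  trig_sum m N x @[N --> \oo] --> bern_poly m x / 2.
Proof.
move=> m1 x0pi; apply/cvgrPdist_le => e e0.
have [N0 hN0] := trig_err_unif _ m1 _ e0.
by exists N0 => // N /= N0N; rewrite distrC; exact: hN0.
Qed.

(** The origin must be excluded: there the sums are 0 while [bern_poly 1] equals -pi. *)
Lemma cvg_trig_sum1 x : 0 < x <= pi ->
  trig_sum 1 N x @[N --> \oo] --> bern_poly 1 x / 2.
Proof.
move=> /andP[x0 xpi]; apply/cvgrPdist_le => e e0.
exists (Num.truncn (4 / (e * x))).+1 => // N /= N0N; rewrite distrC.
apply: le_trans (trig_err1_bound N x _) _; first by rewrite x0.
rewrite ler_pdivrMr ?mulr_gt0// ?ltr_wpDl//.
have := truncnS_gt (4 / (e * x)); rewrite ltr_pdivrMr ?mulr_gt0// => h.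
have N0R : (Num.truncn (4 / (e * x))).+1%:R <= N%:R :> R by rewrite ler_nat.
have : (Num.truncn (4 / (e * x))).+1%:R * (e * x) <= N%:R * (e * x).
  by rewrite ler_wpM2r// mulr_ge0 ?ltW.
have : 0 < e * x by rewrite mulr_gt0.
by lra.
Qed.

End bernoulli_fourier.

(** * Closed form of the pentagonal series *)

Section partial_fractions.
Context {R : comNzRingType}.
Implicit Types (a b : nat) (U V : R).

(** The part in U of the expansion of U^(a+1) V^(b+1). From UV = U + V one gets U^(a+2) V^(b+2) =
    U^(a+2) V^(b+1) + U^(a+1) V^(b+2), and [HSS] shows by Pascal's rule that the coefficients obey
    the same recursion. *)
Let H a b U := \sum_(i < a.+1) 'C(a + b - i, b)%:R * U ^+ i.+1.

Let HSS a b U : H a.+1 b.+1 U = H a.+1 b U + H a b.+1 U.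
Proof.
have -> : H a b.+1 U = \sum_(i < a.+2) 'C(a + b.+1 - i, b.+1)%:R * U ^+ i.+1.
  rewrite big_ord_recr /= (_ : a + b.+1 - a.+1 = b)%N; last by lia.
  by rewrite bin_small// mul0r addr0.
rewrite -big_split; apply: eq_bigr => i _ /=; rewrite -mulrDl -natrD.
have ia : (i <= a.+1)%N by rewrite -ltnS.
have -> : (a.+1 + b.+1 - i = (a.+1 + b - i).+1)%N by lia.
by rewrite addnS -addSn binS addnC.
Qed.

Let H0 b U : H 0 b U = U.
Proof. by rewrite /H big_ord1 add0n subn0 binn mul1r expr1. Qed.

Let Hn0 a U : H a.+1 0 U = U + U * H a 0 U.
Proof.
rewrite /H big_ord_recl bin0 mul1r expr1 mulr_sumr; congr (_ + _).
by apply: eq_bigr => i _; rewrite !bin0 !mul1r -exprS.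
Qed.

(* With U = 1 / x and V = 1 / y, the hypothesis says that x + y = 1. *)
Lemma expr_mulDr a b U V : U * V = U + V ->
  U ^+ a.+1 * V ^+ b.+1 =
  \sum_(i < a.+1) 'C(a + b - i, b)%:R * U ^+ i.+1 +
  \sum_(i < b.+1) 'C(b + a - i, a)%:R * V ^+ i.+1.
Proof.
rewrite -/(H a b U) -/(H b a V) => UV.
have [s] := ubnP (a + b); elim: s a b => [//|s IH] [|a] [|b] abs.
- by rewrite !H0 !expr1.
- rewrite H0 Hn0 addrA -UV expr1 exprS mulrCA -[U]expr1 IH//.
  by rewrite H0 mulrDr expr1 [V * U]mulrC.
- rewrite H0 Hn0 addrAC -UV expr1 exprS -mulrA -[V in X in _ * X]expr1 IH//.
  by rewrite H0 mulrDr addrC.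
have -> : U ^+ a.+2 * V ^+ b.+2 = U ^+ a.+2 * V ^+ b.+1 + U ^+ a.+1 * V ^+ b.+2.
  have -> : U ^+ a.+2 * V ^+ b.+2 = U ^+ a.+1 * V ^+ b.+1 * (U * V).
    by rewrite !exprS; ring.
  by rewrite UV !exprS; ring.
rewrite !IH; [|lia|lia].
by rewrite !HSS addrACA [X in _ + X]addrC.
Qed.

End partial_fractions.

Lemma big_nat_odd_bound {V : zmodType} (n : nat) (F : nat -> V) :
  \sum_(1 <= m < (2 * n + 1).+1) F m = F 1%N +
    \sum_(1 <= j < n.+1) F (2 * j)%N + \sum_(1 <= j < n.+1) F (2 * j + 1)%N.
Proof.
elim: n => [|n IH]; first by rewrite muln0 big_nat1 !big_geq// !addr0.
rewrite (_ : 2 * n.+1 + 1 = (2 * n + 1).+2)%N; last by lia.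
rewrite big_nat_recr// big_nat_recr// IH [in RHS]big_nat_recr//.
rewrite [X in _ = _ + X]big_nat_recr//=.
rewrite (_ : 2 * n.+1 = (2 * n + 1).+1)%N; last by lia.
rewrite (_ : (2 * n + 1).+1 + 1 = (2 * n + 1).+2)%N; last by lia.
by rewrite -!addrA; congr (_ + (_ + _)); rewrite addrCA.
Qed.

(** Index 1 is kept apart because order 1 produces the separate term 2 pi / (3 sqrt 3) of the closed
    form. *)
Lemma big_nat_parity {V : zmodType} (k : nat) (F : nat -> V) : (0 < k)%N ->
  \sum_(1 <= m < k.+1) F m = F 1%N +
    \sum_(1 <= j < (k./2).+1) F (2 * j)%N + \sum_(1 <= j < (k.-1./2).+1) F (2 * j + 1)%N.
Proof.
move=> k0; case: (boolP (odd k)) => ok.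
  have kE : k = (2 * k./2 + 1)%N by lia.
  have -> : (k.-1./2 = k./2)%N by lia.
  by rewrite {1}kE big_nat_odd_bound.
have kE : k = (2 * k.-1./2 + 1).+1 by lia.
have -> : k./2 = (k.-1./2).+1 by lia.
rewrite {1}kE big_nat_recr//= big_nat_odd_bound [in RHS]big_nat_recr//=.
rewrite (_ : 2 * (k.-1./2).+1 = (2 * k.-1./2 + 1).+1)%N; last by lia.
by rewrite addrAC addrA.
Qed.

(** The triple angle formula at pi gives 3 s - 4 s^3 = 0 with s > 0. *)
Lemma sin_pi3 {R : realType} : sin (pi / 3) = Num.sqrt 3 / 2 :> R.
Proof.
have pi0 := pi_gt0 R.
have s0 : 0 < sin (pi / 3 : R) by rewrite sin_gt0_pi//; apply/andP; split; lra.
have E : sin (pi / 3 + (pi / 3 + pi / 3) : R) = 0.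
  by rewrite -[RHS](@sinpi R); congr sin; field.
rewrite !(sinD, cosD) in E.
have C := cos2sin2 (pi / 3 : R); move: s0 E C.
set s := sin _; set c := cos _ => s0 E C.
have s2 : s ^+ 2 = 3 / 4.
  have : s * (s ^+ 2 - 3 / 4) = 0.
    rewrite (_ : s * _ = - (3 * (1 - s ^+ 2) * s - s ^+ 3) / 4); last by field.
    by rewrite -C (_ : _ - _ = 0) ?oppr0 ?mul0r// -[RHS]E; ring.
  by move/eqP; rewrite mulf_eq0 gt_eqF//= subr_eq0 => /eqP.
apply/eqP; rewrite -(eqrXn2 (n := 2)) ?divr_ge0 ?(ltW s0)//.
by rewrite s2 exprMn sqr_sqrtr//; apply/eqP; field.
Qed.

(** * Limits of the alternating sums of U^m + V^m *)

Section alternating_sums.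
Context {R : realType}.
Implicit Types (m j k N : nat).

(* U^m + V^m for U = 1 / (3n) and V = - 1 / (3n - 1), summed over n = j and n = -j. *)
Definition pent_term m j : R :=
  (3 * j%:R)^-1 ^+ m + (- (3 * j%:R)^-1) ^+ m +
  ((- (3 * j%:R - 1)^-1) ^+ m + (3 * j%:R + 1)^-1 ^+ m).

Definition pent_sum m N : R := \sum_(1 <= j < N.+1) (-1) ^+ j * pent_term m j.

Lemma cvg_3n1 : (3 * N + 1)%N @[N --> \oo] --> \oo.
Proof. by apply/cvgnyPge => A; exists A => // N /= AN; lia. Qed.

(** Grouping around multiples of 3. The bound 3N + 1 completes the last triple, and only r = 1 is
    left alone. *)
Lemma sum_nat3 (F : nat -> R) N :
  \sum_(1 <= r < (3 * N + 1).+1) F r = F 1%N +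
  \sum_(1 <= j < N.+1) (F (3 * j - 1)%N + F (3 * j)%N + F (3 * j + 1)%N).
Proof.
elim: N => [|N IH]; first by rewrite muln0 big_nat1 big_geq// addr0.
rewrite (_ : (3 * N.+1 + 1 = (3 * N + 1).+3)%N); last by lia.
do 3 rewrite big_nat_recr//; rewrite IH [in RHS]big_nat_recr//= -!addrA.
by congr (_ + (_ + (F _ + (F _ + F _)))); lia.
Qed.

(** The signs satisfy (-1)^(3j) = (-1)^j and (-1)^(3j+1) = (-1)^(3j-1) = -(-1)^j. The coefficient 3
    is 2 from the two equal powers of U plus 1 for removing the multiples of 3 from the full
    alternating sum; -1 is the isolated index r = 1. *)
Lemma pent_sum_even j N : (0 < j)%N ->
  pent_sum (2 * j) N = -1 + (-1) ^+ j * trig_sum (2 * j) (3 * N + 1) pi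
    - 3 / 3 ^+ (2 * j) * ((-1) ^+ j * trig_sum (2 * j) N pi).
Proof.
move=> j0; have ev : odd (2 * j) = false by rewrite mul2n odd_double.
have S K : (-1) ^+ j * trig_sum (2 * j) K pi =
    - \sum_(1 <= n < K.+1) (-1) ^+ n / n%:R ^+ (2 * j).
  rewrite /trig_sum -sumrN mulr_sumr; apply: eq_bigr => n _.
  rewrite /trig ev cos_natpi mul2n doubleK [_ ^+ j.+1]exprS mulrA mulrA mulrCA -expr2 sqrr_sign.
  by rewrite mulr1 mulN1r mulNr.
rewrite !S sum_nat3 expr1 expr1n divr1 opprD opprK addrA addNr add0r mulrN opprK.
rewrite mulr_sumr -sumrN -big_split /=; apply: eq_big_nat => n /andP[n0 _].
have [n' ->] : exists n', n = n'.+1 by exists n.-1; rewrite prednK.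
rewrite /pent_term.
have sq (x : R) : (- x) ^+ (2 * j) = x ^+ (2 * j).
  by rewrite exprNn mulnC exprM sqrr_sign mul1r.
rewrite !sq.
have E1 : (3 * n'.+1 - 1)%:R = 3 * n'.+1%:R - 1 :> R.
  by rewrite natrB ?natrM//; lia.
have E2 : (3 * n'.+1 + 1)%:R = 3 * n'.+1%:R + 1 :> R by rewrite natrD natrM.
have s2 : (-1) ^+ (3 * n'.+1) = (-1) ^+ n'.+1 :> R.
  by rewrite -signr_odd -[in RHS]signr_odd oddM.
have s1 : (-1) ^+ (3 * n'.+1 - 1) = - (-1) ^+ n'.+1 :> R.
  by rewrite -s2 (_ : 3 * n'.+1 = (3 * n'.+1 - 1).+1)%N ?exprS ?mulN1r ?opprK ?subn1//; lia.
have s3 : (-1) ^+ (3 * n'.+1 + 1) = - (-1) ^+ n'.+1 :> R.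
  by rewrite addn1 exprS s2 mulN1r.
rewrite E1 E2 s1 s2 s3 natrM !exprVn exprMn invfM.
set a := _ ^+ n'.+1; set b := (3 ^+ _)^-1; set c := (_ ^+ _)^-1.
set d := (_ ^+ _)^-1; set e := (_ ^+ _)^-1.
ring.
Qed.

(** The powers of U cancel. The sine of r pi / 3 is 0 at r = 3j and (-1)^j sqrt 3 / 2, up to the
    sign of the residue, at r = 3j + 1 and r = 3j - 1; 2 / sqrt 3 normalises it. *)
Lemma pent_sum_odd j N :
  pent_sum (2 * j + 1) N =
  -1 - 2 / Num.sqrt 3 * ((-1) ^+ j * trig_sum (2 * j + 1) (3 * N + 1) (pi / 3)).
Proof.
have od : odd (2 * j + 1) by rewrite addn1 mul2n /= odd_double.
have hf : ((2 * j + 1)./2 = j)%N by rewrite addn1 mul2n /= uphalf_double.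
have s30 : Num.sqrt 3 != 0 :> R by rewrite gt_eqF// sqrtr_gt0.
have S K : (-1) ^+ j * trig_sum (2 * j + 1) K (pi / 3) =
    - \sum_(1 <= n < K.+1) sin (n%:R * (pi / 3)) / n%:R ^+ (2 * j + 1).
  rewrite /trig_sum -sumrN mulr_sumr; apply: eq_bigr => n _.
  rewrite /trig od hf [_ ^+ j.+1]exprS mulN1r !mulNr mulrN !mulrA.
  by rewrite -[_ ^+ j * _ ^+ j]expr2 sqrr_sign mul1r.
rewrite S mulrN opprK sum_nat3 mul1r expr1n divr1 sin_pi3 mulrDr.
rewrite (_ : 2 / Num.sqrt 3 * (Num.sqrt 3 / 2) = 1); last by field.
rewrite addrA addNr add0r mulr_sumr; apply: eq_big_nat => n /andP[n0 _].
have [n' ->] : exists n', n = n'.+1 by exists n.-1; rewrite prednK.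
rewrite /pent_term.
have sq (x : R) : (- x) ^+ (2 * j + 1) = - x ^+ (2 * j + 1).
  by rewrite exprNn -signr_odd od expr1 mulN1r.
rewrite !sq subrr add0r.
have E1 : (3 * n'.+1 - 1)%:R = 3 * n'.+1%:R - 1 :> R.
  by rewrite natrB ?natrM//; lia.
have E2 : (3 * n'.+1 + 1)%:R = 3 * n'.+1%:R + 1 :> R by rewrite natrD natrM.
have s1 : sin ((3 * n'.+1 - 1)%:R * (pi / 3)) = - (-1) ^+ n'.+1 * (Num.sqrt 3 / 2) :> R.
  rewrite E1 (_ : _ * _ = n'.+1%:R * pi - pi / 3); last by field.
  by rewrite sinB sin_natpi cos_natpi sin_pi3 mul0r sub0r mulNr.
have s2 : sin ((3 * n'.+1)%:R * (pi / 3)) = 0 :> R.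
  by rewrite natrM (_ : _ * _ = n'.+1%:R * pi) ?sin_natpi//; field.
have s3 : sin ((3 * n'.+1 + 1)%:R * (pi / 3)) = (-1) ^+ n'.+1 * (Num.sqrt 3 / 2) :> R.
  rewrite E2 (_ : _ * _ = n'.+1%:R * pi + pi / 3); last by field.
  by rewrite sinD sin_natpi cos_natpi sin_pi3 mul0r add0r.
rewrite s1 s2 s3 E1 E2 !exprVn mul0r addr0.
set a := _ ^+ n'.+1; set d := (_ ^+ _)^-1; set e := (_ ^+ _)^-1.
by field.
Qed.

(** This is the limit with the V-term of n = 0 included. There V = 1, which explains why the sums
    over n <> 0 converge to [pent_lim m - 1]. *)
Definition pent_lim m : R := if odd m
  then - (2 / Num.sqrt 3 * ((-1) ^+ m./2 * (bern_poly m (pi / 3) / 2)))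
  else (1 - 3 / 3 ^+ m) * ((-1) ^+ m./2 * (bern_poly m pi / 2)).

Lemma cvg_pent_sum m : (0 < m)%N -> pent_sum m N @[N --> \oo] --> pent_lim m - 1.
Proof.
have pi0 := pi_gt0 R.
move=> m0; rewrite /pent_lim; case: (boolP (odd m)) => om.
  have em : m = (2 * m./2 + 1)%N by lia.
  rewrite [X in pent_sum X](em) addrC.
  under eq_cvg do rewrite pent_sum_odd.
  apply: cvgB; first exact: cvg_cst.
  apply: cvgMr; apply: cvgMr; rewrite -em.
  have p3 : 0 < (pi / 3 : R) <= pi by apply/andP; split; lra.
  have ct : trig_sum m N (pi / 3 : R) @[N --> \oo] --> bern_poly m (pi / 3 : R) / 2.
    have [->|m1] := eqVneq m 1%N; first exact: cvg_trig_sum1.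
    by apply: cvg_trig_sum; [lia|move/andP: p3 => [/ltW -> ->]].
  exact: (cvg_comp _ (fun K => trig_sum m K (pi / 3)) cvg_3n1 ct).
have em : m = (2 * m./2)%N by lia.
have -> : pent_sum m = fun N => -1 + (-1) ^+ m./2 * trig_sum m (3 * N + 1) pi
    - 3 / 3 ^+ m * ((-1) ^+ m./2 * trig_sum m N pi).
  by apply/funext => N; rewrite [X in pent_sum X]em pent_sum_even -?em//; lia.
rewrite mulrBl mul1r addrAC [X in X - _]addrC.
have ct : trig_sum m N (pi : R) @[N --> \oo] --> bern_poly m (pi : R) / 2.
  by apply: cvg_trig_sum; [lia|rewrite lexx ltW].
apply: cvgB; last by apply: cvgMr; apply: cvgMr.
apply: cvgD; first exact: cvg_cst.
by apply: cvgMr; exact: (cvg_comp _ (fun K => trig_sum m K pi) cvg_3n1 ct).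
Qed.

Lemma pent_lim1 : pent_lim 1 = 2 * pi / (3 * Num.sqrt 3).
Proof.
rewrite /pent_lim /= expr0 mul1r /bern_poly big_nat_recr//= big_nat1 /=.
rewrite bernoulli0 bernoulli1 !expr0 !expr1 fact0 (_ : 1`! = 1%N)// !divr1.
by field; rewrite gt_eqF// sqrtr_gt0.
Qed.

Lemma pent_lim_even j : (0 < j)%N -> pent_lim (2 * j) =
  - ((-1) ^+ j * pi ^+ (2 * j) * bernoulli (2 * j) / ((2 * j)`!)%:R
     * (2 ^+ (2 * j - 1) - 1) * (1 - 3 / 3 ^+ (2 * j))).
Proof.
move=> j0; rewrite /pent_lim mul2n odd_double doubleK -mul2n bern_poly_pi.
have -> : 2 ^+ (2 * j) = 2 * 2 ^+ (2 * j - 1) :> R.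
  by rewrite -exprS; congr (_ ^+ _); lia.
have f0 k : k`!%:R != 0 :> R by rewrite pnatr_eq0 -lt0n fact_gt0.
move: (2 ^+ (2 * j - 1)) (pi ^+ (2 * j)) (3 / _) => x y z.
by field; rewrite f0.
Qed.

(** Since 2 pi = 6 (pi / 3), a power of pi / 3 factors out. The terms i = 0 and i = 1 combine to (1
    - 3 (2j + 1)) / (2j + 1)!, that is -2 (3j + 1) / (2j + 1)!; the other odd i vanish, and the even
    i = 2l form the inner sum. *)
Lemma bern_poly_pi3 j : bern_poly (2 * j + 1) (pi / 3 : R) =
  - 2 * (pi / 3) ^+ (2 * j + 1) * ((3 * j + 1)%:R / ((2 * j + 1)`!)%:R
     - 3 * \sum_(1 <= l < j.+1) (6 ^+ (2 * l - 1) * bernoulli (2 * l)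
                   / (((2 * j - 2 * l + 1)`!)%:R * ((2 * l)`!)%:R))).
Proof.
have f0 k : k`!%:R != 0 :> R by rewrite pnatr_eq0 -lt0n fact_gt0.
set m := (2 * j + 1)%N.
have -> : bern_poly m (pi / 3 : R) = (pi / 3) ^+ m *
    \sum_(0 <= i < m.+1) 6 ^+ i * bernoulli i / (i`!%:R * (m - i)`!%:R).
  rewrite mulr_sumr /bern_poly; apply: eq_big_nat => i /andP[_ im].
  have -> : 2 * pi = 6 * (pi / 3) :> R by field.
  have -> : (pi / 3) ^+ m = (pi / 3) ^+ i * (pi / 3) ^+ (m - i) :> R.
    by rewrite -exprD subnKC.
  rewrite exprMn; set x := 6 ^+ i; set y := _ ^+ i; set z := _ ^+ (m - i).
  by field; rewrite !f0.
rewrite [-2 * _]mulrC -mulrA; congr (_ * _).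
rewrite big_nat_recl// -(big_add1 _ _ 0 m.+1 predT (fun i => 6 ^+ i * bernoulli i / (i`!%:R * (m - i)`!%:R))).
rewrite big_nat_odd_bound bernoulli0 bernoulli1 expr0 expr1 subn0 fact0.
rewrite [X in _ + (_ + X)]big_nat [X in _ + (_ + X)]big1; last first.
  move=> l /andP[l0 _]; rewrite bernoulli_odd ?mulr0 ?mul0r//; first by lia.
  by rewrite addn1 mul2n /= odd_double.
rewrite (eq_big_nat _ _ (F2 := fun l => 6 * (6 ^+ (2 * l - 1) * bernoulli (2 * l) /
    (((2 * j - 2 * l + 1)`!)%:R * ((2 * l)`!)%:R)))); last first.
  move=> l /andP[l0 lj].
  have -> : 6 ^+ (2 * l) = 6 * 6 ^+ (2 * l - 1) :> R.
    by rewrite -exprS; congr (_ ^+ _); lia.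
  have -> : (m - 2 * l = 2 * j - 2 * l + 1)%N by rewrite /m; lia.
  by rewrite [X in _ / X]mulrC !mulrA.
rewrite -mulr_sumr; set S := \sum_(_ <= _ < _) _.
have -> : m`!%:R = (2 * j%:R + 1) * (m - 1)`!%:R :> R.
  by rewrite /m addn1 subn1 factS natrM -natr1 natrM.
rewrite (_ : 1`! = 1%N)// natrD natrM.
by field; rewrite f0 -natrM natr1 pnatr_eq0.
Qed.

Lemma pent_lim_odd j : pent_lim (2 * j + 1) = 2 / Num.sqrt 3 *
  ((pi / 3) ^+ (2 * j + 1) * (-1) ^+ j *
   ((3 * j + 1)%:R / ((2 * j + 1)`!)%:R
     - 3 * \sum_(1 <= l < j.+1) (6 ^+ (2 * l - 1) * bernoulli (2 * l)
                   / (((2 * j - 2 * l + 1)`!)%:R * ((2 * l)`!)%:R)))).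
Proof.
rewrite /pent_lim bern_poly_pi3 {1 2}addn1 mul2n /= odd_double uphalf_double /=.
have s30 : Num.sqrt 3 != 0 :> R by rewrite gt_eqF// sqrtr_gt0.
by rewrite -mul2n; field; rewrite s30 pnatr_eq0 -lt0n fact_gt0.
Qed.

(** The constants 1 sum to 'C(2k - 1, k) by the hockey-stick identity; the limits are then sorted
    into order 1, even orders and odd orders above 1. *)
Lemma sum_pent_lim k : (0 < k)%N ->
  \sum_(1 <= m < k.+1) 'C(2 * k - m - 1, k - 1)%:R * (1 - pent_lim m) =
  'C(2 * k - 1, k)%:R
      - 2 * pi / (3 * Num.sqrt 3) * 'C(2 * k - 2, k - 1)%:R
      + \sum_(1 <= j < (k./2).+1)
          ((-1) ^+ j * pi ^+ (2 * j) * bernoulli (2 * j) / ((2 * j)`!)%:R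
           * (2 ^+ (2 * j - 1) - 1) * (1 - 3 / 3 ^+ (2 * j))
           * 'C(2 * k - 2 * j - 1, k - 1)%:R)
      - 2 / Num.sqrt 3 *
        \sum_(1 <= j < ((k.-1)./2).+1)
          ((pi / 3) ^+ (2 * j + 1) * (-1) ^+ j
           * 'C(2 * k - 2 * j - 2, k - 1)%:R
           * ((3 * j + 1)%:R / ((2 * j + 1)`!)%:R
              - 3 * \sum_(1 <= l < j.+1)
                  (6 ^+ (2 * l - 1) * bernoulli (2 * l)
                   / (((2 * j - 2 * l + 1)`!)%:R * ((2 * l)`!)%:R)))).
Proof.
move=> k0; under eq_bigr do rewrite mulrBr mulr1.
rewrite sumrB.
have hockey n p : (\sum_(1 <= m < p.+2) 'C(n + p.+1 - m, n) = 'C(n + p.+1, n.+1))%N.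
  elim: p => [|p IH]; first by rewrite big_nat1 addnK binn addn1 binn.
  rewrite big_add1 /= big_nat_recl// subn1 addnS /=.
  under eq_bigr do rewrite subSS.
  by rewrite -(big_add1 _ _ 0 p.+2 predT (fun i => 'C(n + p.+1 - i, n))) IH binS addnC.
rewrite (_ : \sum_(1 <= m < k.+1) _ = 'C(2 * k - 1, k)%:R); last first.
  case: k k0 => // k _; have := hockey k k.
  rewrite (_ : k + k.+1 = 2 * k.+1 - 1)%N; last by lia.
  move=> <-; rewrite natr_sum; apply: eq_bigr => m _.
  by congr ('C(_, _)%:R); lia.
rewrite -!addrA; congr (_ + _).
rewrite big_nat_parity// pent_lim1 !opprD -!addrA; congr (_ + _).
  by rewrite mulrC; congr (- (_ * 'C(_, _)%:R)); lia.
congr (_ + _).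
  rewrite -sumrN; apply: eq_big_nat => j /andP[j0 _].
  by rewrite pent_lim_even// mulrN opprK mulrC.
congr (- _); rewrite mulr_sumr; apply: eq_bigr => j _.
rewrite pent_lim_odd (_ : 2 * k - (2 * j + 1) - 1 = 2 * k - 2 * j - 2)%N; last by lia.
by ring.
Qed.

(** The two reciprocals are -6 UV for n = j and n = -j. The partial fraction expansion with equal
    exponents has the same coefficient on U^m and V^m, so the double sum can be exchanged. *)
Lemma pent_series k N : (0 < k)%N ->
  \sum_(1 <= j < N.+1) (-1) ^+ j *
    ((j%:R * (3 * j%:R - 1) / 2)^-1 ^+ k + (j%:R * (3 * j%:R + 1) / 2)^-1 ^+ k) =
  (-6) ^+ k * \sum_(1 <= m < k.+1) 'C(2 * k - m - 1, k - 1)%:R * pent_sum m N.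
Proof.
case: k => // k _; rewrite (_ : k.+1 - 1 = k)%N; last by rewrite subn1.
transitivity ((-6) ^+ k.+1 * \sum_(1 <= j < N.+1) (-1) ^+ j *
  \sum_(1 <= m < k.+2) 'C(2 * k.+1 - m - 1, k)%:R * pent_term m j); last first.
  congr (_ * _); rewrite /pent_sum.
  under eq_bigr do rewrite mulr_sumr.
  rewrite exchange_big /=; apply: eq_bigr => m _.
  rewrite mulr_sumr; apply: eq_bigr => j _.
  by rewrite mulrCA.
rewrite mulr_sumr; apply: eq_big_nat => j /andP[j0 _]; rewrite mulrCA; congr (_ * _).
have j1 : 1 <= j%:R :> R by rewrite ler1n.
have jp : j%:R != 0 :> R by rewrite gt_eqF// ltr0n.
have jm : 3 * j%:R - 1 != 0 :> R by rewrite gt_eqF//; lra.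
have jq : 3 * j%:R + 1 != 0 :> R by rewrite gt_eqF//; lra.
have pf (U V : R) : U * V = U + V -> (U * V) ^+ k.+1 =
    \sum_(1 <= m < k.+2) 'C(2 * k.+1 - m - 1, k)%:R * (U ^+ m + V ^+ m).
  move=> UV; rewrite exprMn expr_mulDr// big_add1 big_mkord -big_split /=.
  apply: eq_bigr => i _; rewrite -mulrDr; congr ('C(_, _)%:R * _); lia.
have -> : (j%:R * (3 * j%:R - 1) / 2)^-1 =
    -6 * ((3 * j%:R)^-1 * - (3 * j%:R - 1)^-1) :> R.
  by field; rewrite jp jm.
have -> : (j%:R * (3 * j%:R + 1) / 2)^-1 =
    -6 * (- (3 * j%:R)^-1 * (3 * j%:R + 1)^-1) :> R.
  by field; rewrite jp jq.
rewrite !(exprMn _ (-6 : R)) -mulrDr; congr (_ * _).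
rewrite pf; last by field; rewrite jp jm.
rewrite pf; last by field; rewrite jp jq.
rewrite -big_split; apply: eq_bigr => m _; rewrite /= -mulrDr /pent_term.
by congr (_ * _); rewrite addrACA.
Qed.

Lemma cvg_pent_series k : (0 < k)%N ->
  \sum_(1 <= j < N.+1) (-1) ^+ j *
    ((j%:R * (3 * j%:R - 1) / 2)^-1 ^+ k + (j%:R * (3 * j%:R + 1) / 2)^-1 ^+ k)
  @[N --> \oo] --> - ((-6) ^+ k *
    \sum_(1 <= m < k.+1) 'C(2 * k - m - 1, k - 1)%:R * (1 - pent_lim m)).
Proof.
move=> k0; under eq_cvg do rewrite pent_series//.
rewrite (_ : - _ = (-6) ^+ k *
  \sum_(1 <= m < k.+1) 'C(2 * k - m - 1, k - 1)%:R * (pent_lim m - 1)); last first.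
  rewrite -mulrN -sumrN; congr (_ * _).
  by apply: eq_bigr => m _; rewrite -mulrN opprB.
have h : \sum_(1 <= m < k.+1) 'C(2 * k - m - 1, k - 1)%:R * pent_sum m N @[N --> \oo] -->
    \sum_(1 <= m < k.+1) 'C(2 * k - m - 1, k - 1)%:R * (pent_lim m - 1).
  rewrite big_nat; under eq_cvg do rewrite big_nat.
  apply: cvg_big; first exact: add_continuous.
  by move=> m /andP[m0 _]; apply: cvgMr; exact: cvg_pent_sum.
exact: cvgMr h.
Qed.

End alternating_sums.

(** * Shanks' identity *)

Section shanks.
Context {R : comNzRingType}.
Implicit Types (q : R) (n s j : nat).

(** The quotient P_n / P_s as a product, free of division; [qprod q n 0] is P_n. *)
Definition qprod q n s : R := \prod_(s.+1 <= i < n.+1) (1 - q ^+ i).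

(* The exponents n (3n - 1) / 2 and n (3n + 1) / 2. *)
Definition pent1 j := (j * j + 'C(j, 2))%N.
Definition pent2 j := (j * j + 'C(j.+1, 2))%N.

Lemma qprodn q n : qprod q n n = 1.
Proof. by rewrite /qprod big_geq. Qed.

Lemma qprodS q n s : (s <= n)%N -> qprod q n.+1 s = qprod q n s * (1 - q ^+ n.+1).
Proof. by move=> sn; rewrite /qprod big_nat_recr. Qed.

Lemma qprod_recl q n s : (s < n)%N -> qprod q n s = (1 - q ^+ s.+1) * qprod q n s.+1.
Proof. by move=> sn; rewrite /qprod big_ltn. Qed.

(* Shanks' finite form of the pentagonal number theorem. *)
Lemma shanks q n :
  \sum_(0 <= s < n.+1) (-1) ^+ s * qprod q n s * q ^+ (s * n + 'C(s.+1, 2)) =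
  1 + \sum_(1 <= j < n.+1) (-1) ^+ j * (q ^+ pent1 j + q ^+ pent2 j).
Proof.
elim: n => [|n IH].
  by rewrite big_nat1 big_geq// qprodn expr0 mul0n bin_small// expr0 !mulr1 addr0.
rewrite [in RHS]big_nat_recr//= addrA -IH {IH}.
rewrite big_nat_recr//= qprodn mulr1 -/(pent2 n.+1) mulrDr addrA; congr (_ + _).
set S := \sum_(_ <= _ < _) _; set S' := \sum_(_ <= _ < _) _.
(* The change of the sum from n to n + 1 telescopes, with partial sums [- B t]. At t = n this is the
   new term with exponent [pent1 n.+1]; the one with [pent2 n.+1] was the last summand s = n + 1,
   split off above. *)
pose B s := (-1) ^+ s * qprod q n s * q ^+ ('C(s.+1, 2) + s.+1 * n.+1).
suff E t : (t <= n)%N -> \sum_(0 <= s < t.+1)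
    ((-1) ^+ s * qprod q n.+1 s * q ^+ (s * n.+1 + 'C(s.+1, 2)) -
     (-1) ^+ s * qprod q n s * q ^+ (s * n + 'C(s.+1, 2))) = - B t.
  apply/eqP; rewrite addrC -subr_eq -sumrB E//; apply/eqP.
  by rewrite /B qprodn mulr1 exprS mulN1r mulNr /pent1 addnC.
elim: t => [_|t IH tn].
  rewrite big_nat1 /B qprodS// expr0 !mul0n bin_small// expr0 !mul1r mulr1.
  by rewrite add0n mul1n; ring.
rewrite big_nat_recr// IH ?(ltnW tn)// /B qprodS// (qprod_recl _ _ _ tn).
rewrite (binS t.+1 1) bin1.
have -> : (t.+1 * n.+1 = t.+1 * n + t.+1)%N by rewrite mulnS addnC.
have -> : (t.+2 * n.+1 = t.+1 * n + t.+1 + n.+1)%N by rewrite mulSn mulnS; lia.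
move: 'C(t.+1, 2) (t.+1 * n)%N (qprod _ _ _) => b a e.
rewrite !exprD [(-1) ^+ t.+1]exprS /=.
set x := q ^+ a; set y := q ^+ b; set c := q ^+ t.+1; set d := q ^+ n.+1.
by set f := (-1) ^+ t; ring.
Qed.

End shanks.

(** * Positive form of Shanks' identity and decay of its error *)

Section shanks_bounds.
Context {R : realType}.
Implicit Types (q : R) (n s : nat).

Lemma qprod_itv q n s : 0 <= q <= 1 -> 0 <= qprod q n s <= 1.
Proof.
move=> /andP[q0 q1]; have h i : 0 <= 1 - q ^+ i <= 1.
  by rewrite subr_ge0 exprn_ile1//= lerBlDr lerDl exprn_ge0.
rewrite /qprod; elim/big_ind: _ => [|x y /andP[x0 x1] /andP[y0 y1]|//].
  by rewrite ler01 lexx.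
by rewrite mulr_ge0//= mulr_ile1.
Qed.

(** Pentagonal exponents sorted by the sign of their coefficient: odd j occurs positively in 1 -
    P_n, even j negatively. *)
Definition pent_exps (b : bool) n : seq nat :=
  flatten [seq [:: pent1 j; pent2 j] | j <- iota 1 n & odd j == b].

Definition shanks_exps n : seq nat := [seq (s * n + 'C(s.+1, 2))%N | s <- iota 1 n].

Lemma sum_pent_exps (F : nat -> R) n :
  \sum_(e <- pent_exps true n) F e - \sum_(e <- pent_exps false n) F e =
  - \sum_(1 <= j < n.+1) (-1) ^+ j * (F (pent1 j) + F (pent2 j)).
Proof.
have E b : \sum_(e <- pent_exps b n) F e =
    \sum_(j <- iota 1 n | odd j == b) (F (pent1 j) + F (pent2 j)).
  rewrite /pent_exps big_flatten big_map big_filter; apply: eq_bigr => j _.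
  by rewrite !big_cons big_nil /= addr0.
rewrite !E big_mkcond [X in _ - X]big_mkcond /= -sumrB -sumrN /index_iota subSS subn0.
apply: eq_bigr => j _; rewrite -[in RHS]signr_odd.
by case: (odd j) => /=; rewrite ?subr0 ?sub0r ?expr0 ?expr1 ?mulN1r ?mul1r ?opprK.
Qed.

(** The summand s = 0 of Shanks' identity is P_n; the others are bounded by powers of q since
    partial products lie in [0, 1]. No subtraction of sums occurs, so both inequalities can be
    integrated between nonnegative functions. *)
Lemma pent_sandwich q n : 0 <= q <= 1 ->
  1 - qprod q n 0 + \sum_(e <- pent_exps false n) q ^+ e <=
    \sum_(e <- pent_exps true n ++ shanks_exps n) q ^+ e /\
  \sum_(e <- pent_exps true n) q ^+ e <=
    1 - qprod q n 0 + \sum_(e <- pent_exps false n ++ shanks_exps n) q ^+ e.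
Proof.
move=> q01; have sh := shanks q n.
rewrite big_ltn// expr0 mul1r mul0n bin_small// expr0 mulr1 in sh.
have AB := sum_pent_exps (fun e => q ^+ e) n.
set D := (X in _ + X = _) in sh; set C := (X in _ = _ + X) in sh.
rewrite -/C in AB; move: AB; rewrite !big_cat /=.
set A := \sum_(e <- pent_exps true n) _; set B := \sum_(e <- pent_exps false n) _.
set E := \sum_(e <- shanks_exps n) _ => AB.
have : `|D| <= E.
  rewrite /E /shanks_exps big_map /D; apply: le_trans (ler_norm_sum _ _ _) _.
  rewrite /index_iota subSS subn0; apply: ler_sum => s _.
  have /andP[q0 q1] := q01; have /andP[p0 p1] := qprod_itv q n s q01.
  rewrite !normrM normrX normrN1 expr1n mul1r (ger0_norm p0).
  by rewrite ger0_norm ?exprn_ge0// ler_piMl// exprn_ge0.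
by rewrite ler_norml => /andP[DE1 DE2]; split; lra.
Qed.

Lemma pent_exps_gt0 b n e : e \in pent_exps b n -> (0 < e)%N.
Proof.
move=> /flattenP[_ /mapP[j + ->]].
rewrite mem_filter mem_iota => /andP[_ /andP[j0 _]].
by rewrite !inE => /orP[] /eqP ->; rewrite /pent1 /pent2 addn_gt0 muln_gt0 j0.
Qed.

Lemma shanks_exps_gt0 n e : e \in shanks_exps n -> (0 < e)%N.
Proof.
move=> /mapP[s]; rewrite mem_iota => /andP[s0 sn] ->.
by rewrite addn_gt0 muln_gt0 s0 /=; apply/orP; left; lia.
Qed.

(** Each exponent is at least s n, so the sum is at most (1 + 1/2 + ... + 1/n) / n, a Cesaro mean of
    the harmonic sequence. *)
Lemma cvg_shanks_exps k : (0 < k)%N ->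
  \sum_(e <- shanks_exps n) (e%:R^-1 ^+ k : R) @[n --> \oo] --> 0.
Proof.
move=> k0.
have : arithmetic_mean (@harmonic R) @ \oo --> 0.
  by apply: cesaro; exact: cvg_harmonic.
move=> mean0; rewrite -cvg_shiftS.
apply: squeeze_cvgr mean0; last exact: cvg_cst.
near=> n; apply/andP; split.
  by apply: sumr_ge0 => e _; rewrite exprn_ge0// invr_ge0.
rewrite /arithmetic_mean /series /= /shanks_exps big_map mulr_sumr.
rewrite -[iota 1 n.+1]/(iota (1 + 0) n.+1) iotaDl big_map.
rewrite -[X in iota 0 X]subn0 -/(index_iota 0 n.+1).
apply: ler_sum_nat => i _; rewrite add1n /harmonic /=.
have e0 : (0 < i.+1 * n.+1)%N by rewrite muln_gt0.
apply: (@le_trans _ _ ((i.+1 * n.+1)%:R^-1)); last first.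
  by rewrite natrM invfM mulrC.
apply: (@le_trans _ _ ((i.+1 * n.+1 + 'C(i.+2, 2))%:R^-1)).
  rewrite -[leRHS]expr1 ler_wiXn2l ?invr_ge0//.
  by rewrite invf_le1 ?ler1n ?ltr0n ?addn_gt0 ?e0.
by rewrite lef_pV2 ?posrE ?ltr0n ?addn_gt0 ?e0// ler_nat leq_addr.
Unshelve. all: by end_near. Qed.

End shanks_bounds.

(** * Moments and tails *)

Section exponential_moments.
Context {R : realType}.
Implicit Types (k : nat) (a s : R).
Let mu : {measure set _ -> \bar R} := @lebesgue_measure R.

(** Repeated integration by parts of s^k e^(-a s), normalised to vanish at +oo. *)
Fixpoint exp_primitive a k s : R :=
  - a^-1 * (s ^+ k * expR (- a * s)) +
  (if k is k'.+1 then k%:R / a * exp_primitive a k' s else 0).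

Lemma is_derive_expRZ a s :
  is_derive s (1 : R) (fun x => expR (a * x)) (a * expR (a * s)).
Proof. by apply: is_derive_comp_scale; exact: is_derive_expR. Qed.

Lemma is_derive_exp_primitive a k s : a != 0 ->
  is_derive s (1 : R) (exp_primitive a k) (s ^+ k * expR (- a * s)).
Proof.
move=> a0; have De := is_derive_expRZ (- a) s.
elim: k => [|k IH].
  rewrite (_ : exp_primitive a 0 = fun x => - a^-1 * expR (- a * x)); last first.
    by apply/funext => x; rewrite /= expr0 mul1r addr0.
  apply: is_derive_eq (is_deriveZf _ _ _ _ De) _.
  by rewrite expr0 mulrA mulrNN mulVf.
apply: is_derive_eq (is_deriveDf _ _ _ _ _
  (is_deriveZf _ (- a^-1) _ _ (is_deriveMf _ _ _ _ _ (is_derive_exprS k s) De))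
  (is_deriveZf _ (k.+1%:R / a) _ _ IH)) _.
by field.
Qed.

Lemma exp_primitive0 a k : a != 0 -> exp_primitive a k 0 = - (k`!%:R / a ^+ k.+1).
Proof.
move=> a0; elim: k => [|k IH] /=.
  by rewrite mulr0 expR0 fact0 expr0 expr1; field.
by rewrite IH expr0n /= mul0r mulr0 add0r factS natrM mulrN !exprS; field; rewrite expf_neq0.
Qed.

(** From e^(a s) >= (a s)^(k+1) / (k+1)! the product is at most c / s, with c = (k+1)! / a^(k+1). *)
Lemma cvg_expR_poly a k : 0 < a -> s ^+ k * expR (- a * s) @[s --> +oo] --> 0.
Proof.
move=> a0; pose c := (k.+1`!%:R / a ^+ k.+1 : R).
have c0 : 0 <= c by rewrite divr_ge0// exprn_ge0// ltW.
have h : c * s^-1 @[s --> +oo] --> 0.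
  rewrite -[X in _ --> X](mulr0 c); apply: cvgMr.
  by apply/gtr0_cvgV0; [exact: nbhs_pinfty_gt|exact: cvg_id].
apply: squeeze_cvgr h; last exact: cvg_cst.
near=> s.
have s0 : 0 < s by near: s; exact: nbhs_pinfty_gt.
have as0 : 0 <= a * s by rewrite mulr_ge0// ltW.
rewrite mulr_ge0 ?exprn_ge0 ?expR_ge0 ?(ltW s0)//=.
have := expR_ge1Dxn k as0; set E := expR _ => hE.
have {}hE : (a * s) ^+ k.+1 / k.+1`!%:R <= E by lra.
rewrite mulNr expRN -/E.
have fp : 0 < k.+1`!%:R :> R by rewrite ltr0n fact_gt0.
have pp : 0 < (a * s) ^+ k.+1 / k.+1`!%:R.
  by rewrite divr_gt0// exprn_gt0// mulr_gt0.
apply: (@le_trans _ _ (s ^+ k * ((a * s) ^+ k.+1 / k.+1`!%:R)^-1)).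
  rewrite ler_wpM2l ?exprn_ge0 ?(ltW s0)// lef_pV2 ?posrE//.
  exact: lt_le_trans pp hE.
rewrite le_eqVlt; apply/orP; left; apply/eqP.
rewrite /c exprMn (exprS s).
by field; rewrite !gt_eqF ?exprn_gt0.
Unshelve. all: by end_near. Qed.

Lemma cvg_exp_primitive a k : 0 < a -> exp_primitive a k s @[s --> +oo] --> 0.
Proof.
move=> a0; have h n : - a^-1 * (s ^+ n * expR (- a * s)) @[s --> +oo] --> 0.
  by rewrite -[X in _ --> X](mulr0 (- a^-1)); apply: cvgMr; exact: cvg_expR_poly.
elim: k => [|k IH] /=.
  rewrite -[X in _ --> X]addr0; apply: cvgD; [exact: h|exact: cvg_cst].
rewrite -[X in _ --> X]addr0; apply: cvgD; first exact: (h k.+1).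
by rewrite -[X in _ --> X](mulr0 (k.+1%:R / a)); apply: cvgMr.
Qed.

Lemma continuous_expR_poly a k : continuous (fun s : R => s ^+ k * expR (- a * s)).
Proof.
move=> s; apply: cvgM; first exact: exprn_continuous.
have [De _] := is_derive_expRZ (- a) s.
by apply: (differentiable_continuous (f := fun x => expR (- a * x))); apply/derivable1_diffP.
Qed.

Lemma integral_expR_poly a k : 0 < a ->
  (\int[mu]_(s in `]0%R, +oo[) (s ^+ k * expR (- a * s))%:E =
   (k`!%:R / a ^+ k.+1)%:E)%E.
Proof.
move=> a0; have aN0 : a != 0 by rewrite gt_eqF.
have D s := is_derive_exp_primitive a k s aN0.
rewrite integral_itv_obnd_cbnd; last first.
  apply/measurable_EFinP; apply: measurable_funTS.
  by apply: continuous_measurable_fun; exact: continuous_expR_poly.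
rewrite (@ge0_continuous_FTC2y _ _ (exp_primitive a k) _ 0).
- by rewrite exp_primitive0// EFinN oppeK add0e.
- by move=> s s0; rewrite mulr_ge0 ?exprn_ge0 ?expR_ge0.
- by apply: continuous_subspaceT; exact: continuous_expR_poly.
- exact: cvg_exp_primitive.
- by move=> s _; have [] := D s.
- apply: cvg_at_right_filter; apply: differentiable_continuous.
  by apply/derivable1_diffP; have [] := D 0.
- by move=> s _; rewrite derive1E; have [_ ->] := D s.
Qed.

End exponential_moments.

Section layer_cake.
Context {R : realType}.
Let mu : {measure set _ -> \bar R} := @lebesgue_measure R.

Lemma continuous_natM_expr k : continuous (fun s : R => k.+1%:R * s ^+ k).
Proof. by move=> s; apply: cvgMr; exact: exprn_continuous. Qed.

Lemma integral_power k (y : R) : 0 <= y ->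
  (\int[mu]_(s in `]0%R, y[) (k.+1%:R * s ^+ k)%:E = (y ^+ k.+1)%:E)%E.
Proof.
have c := continuous_natM_expr k.
rewrite le_eqVlt => /predU1P[<-|y0].
  by rewrite set_itvoo0 integral_set0 expr0n.
have mf (A : set R) : measurable A -> measurable_fun A (fun s : R => (k.+1%:R * s ^+ k)%:E).
  move=> mA; apply/measurable_EFinP; apply: measurable_funTS.
  exact: continuous_measurable_fun.
rewrite integral_itv_bndo_bndc; last exact: mf.
rewrite integral_itv_obnd_cbnd; last exact: mf.
rewrite (@continuous_FTC2 _ _ (fun s => s ^+ k.+1))//.
- by rewrite expr0n /= sube0.
- exact: continuous_subspaceT.
- have D (s : R) := is_derive_exprS k s; split.
  + by move=> s _; have [] := D s.
  + by apply: cvg_at_right_filter; exact: exprn_continuous.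
  + by apply: cvg_at_left_filter; exact: exprn_continuous.
- by move=> s _; rewrite derive1E; have [_ ->] := is_derive_exprS k s.
Qed.

(** Write Y^(k+1) as the integral of (k+1) s^k over 0 < s < Y and exchange the integrals by
    Tonelli. *)
Lemma moment_tail d (T : measurableType d) (P : probability T R) (Y : T -> R) k :
  measurable_fun setT Y -> (forall w, 0 <= Y w) ->
  (\int[P]_w (Y w ^+ k.+1)%:E =
   \int[mu]_(s in `]0%R, +oo[) ((k.+1%:R * s ^+ k)%:E * P [set w | (s < Y w)%R]))%E.
Proof.
move=> mY Y0; pose GR := measurableTypeR R.
transitivity (\int[P]_w \int[mu]_s ((k.+1%:R * s ^+ k) * \1_`]0%R, Y w[ s)%:E)%E.
  apply: eq_integral => w _; rewrite -integral_power// integral_mkcond.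
  apply: eq_integral => s _; rewrite patchE indicE.
  by case: ifPn => _; rewrite ?mulr1 ?mulr0.
rewrite (fubini_tonelli (fun p : T * GR =>
    ((k.+1%:R * p.2 ^+ k) * \1_`]0%R, Y p.1[ p.2)%:E))//=; last 2 first.
- apply/measurable_EFinP; apply: measurable_funM.
    apply: (measurableT_comp (f := fun s : R => k.+1%:R * s ^+ k)) => //.
    by apply: continuous_measurable_fun; exact: continuous_natM_expr.
  apply: measurable_indic.
  pose f1 (p : T * GR) := (0 < p.2)%R; pose f2 (p : T * GR) := (p.2 < Y p.1)%R.
  rewrite [X in measurable X](_ : _ = f1 @^-1` [set true] `&` f2 @^-1` [set true]); last first.
    by apply/seteqP; split => p; rewrite /= in_itv/= => /andP.
  apply: measurableI.
  - have : measurable_fun setT f1 by exact: measurable_fun_ltr.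
    by move=> /(_ measurableT [set true]); rewrite setTI; exact.
  - have : measurable_fun setT f2.
      by apply: measurable_fun_ltr => //; exact: measurableT_comp.
    by move=> /(_ measurableT [set true]); rewrite setTI; exact.
- move=> p; rewrite lee_fin indicE; case: (boolP (_ \in _)); rewrite ?mulr0// mulr1.
  by rewrite inE /= in_itv/= => /andP[/ltW p0 _]; rewrite mulr_ge0// exprn_ge0.
rewrite [RHS]integral_mkcond; apply: eq_integral => s _; rewrite patchE.
case: ifPn => [|]; rewrite ?inE /= ?notin_setE /= in_itv/= andbT => s0; last first.
  apply: integral0_eq => w _; rewrite indicE memNset ?mulr0//=.
  by rewrite in_itv/= (negbTE (introN idP s0)).
under eq_integral do rewrite EFinM.
have mS : measurable [set w | s < Y w].
  have : measurable_fun setT (fun w => s < Y w) by exact: measurable_fun_ltr.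
  by move=> /(_ measurableT [set true]); rewrite setTI; exact.
transitivity (\int[P]_w ((k.+1%:R * s ^+ k)%:E * (\1_[set w | s < Y w] w)%:E))%E.
  apply: eq_integral => w _; congr (_ * _%:E)%E; rewrite !indicE; congr (_%:R).
  by congr nat_of_bool; apply/idP/idP; rewrite !inE /= in_itv/= s0.
rewrite ge0_integralZl_EFin//; last 2 first.
- exact/measurable_EFinP/measurable_indic.
- by rewrite mulr_ge0// exprn_ge0// ltW.
by rewrite integral_indic// setIT.
Qed.

End layer_cake.

Section tail_sandwich.
Context {R : realType}.
Implicit Types (k n : nat) (r : seq nat).
Let mu : {measure set _ -> \bar R} := @lebesgue_measure R.
Let D : set R := `]0%R, +oo[%classic.
Let mD : measurable D. Proof. exact: measurable_itv. Qed.

(** For positive exponents e, the integral over s > 0 of (k+1) s^k times the sum of the q^e at q =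
    e^(-s). *)
Definition exps_moment k r : R := \sum_(e <- r) k.+1`!%:R * e%:R^-1 ^+ k.+1.

Let exps_tail k r (s : R) : R := k.+1%:R * s ^+ k * \sum_(e <- r) expR (- s) ^+ e.

Let measurable_weight k : measurable_fun setT (fun s : R => k.+1%:R * s ^+ k).
Proof. by apply: continuous_measurable_fun; exact: continuous_natM_expr. Qed.

Let measurable_expRN : measurable_fun setT (fun s : R => expR (- s)).
Proof. by apply: measurableT_comp => //; exact: measurable_oppr. Qed.

Let exps_tail_ge0 k r s : D s -> (0 <= (exps_tail k r s)%:E)%E.
Proof.
rewrite /D /= in_itv/= andbT => s0; rewrite lee_fin mulr_ge0//.
  by rewrite mulr_ge0// exprn_ge0// ltW.
by apply: sumr_ge0 => e _; rewrite exprn_ge0// expR_ge0.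
Qed.

Let measurable_exps_tail k r : measurable_fun D (fun s => (exps_tail k r s)%:E).
Proof.
apply/measurable_EFinP; apply: measurable_funTS; apply: measurable_funM => //.
by apply: measurable_sum => e; apply: measurable_funX.
Qed.

Let integral_exps_tail k r : (forall e, e \in r -> (0 < e)%N) ->
  (\int[mu]_(s in D) (exps_tail k r s)%:E = (exps_moment k r)%:E)%E.
Proof.
move=> r0; pose f e s := (k.+1%:R * s ^+ k * expR (- s) ^+ e : R).
have f0 e s : D s -> (0 <= (f e s)%:E)%E.
  rewrite /D /= in_itv/= andbT => s0.
  by rewrite lee_fin !mulr_ge0// ?exprn_ge0 ?expR_ge0// ltW.
have mf e : measurable_fun D (fun s => (f e s)%:E).
  apply/measurable_EFinP; apply: measurable_funTS; apply: measurable_funM => //.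
  exact: measurable_funX.
transitivity (\int[mu]_(s in D) \sum_(e <- r) (f e s)%:E)%E.
  by apply: eq_integral => s _; rewrite /exps_tail mulr_sumr -sumEFin.
rewrite ge0_integral_sum// /exps_moment -sumEFin; apply: eq_big_seq => e /r0 e0.
have -> : (fun s => (f e s)%:E) =
    (fun s => k.+1%:R%:E * (s ^+ k * expR (- e%:R * s))%:E)%E.
  by apply/funext => s; rewrite -EFinM /f -expRM_natl mulrN mulNr mulrA.
rewrite ge0_integralZl_EFin//; last 2 first.
- move=> s; rewrite /D /= in_itv/= andbT => s0.
  by rewrite lee_fin mulr_ge0 ?expR_ge0// exprn_ge0// ltW.
- apply/measurable_EFinP; apply: measurable_funTS.
  by apply: continuous_measurable_fun; exact: continuous_expR_poly.
rewrite integral_expR_poly ?ltr0n// -EFinM.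
by rewrite mulrA -natrM -factS exprVn.
Qed.

Lemma measurable_qprod n : measurable_fun setT (fun s : R => qprod (expR (- s)) n 0).
Proof.
elim: n => [|n IH].
  rewrite (_ : (fun s => _) = cst 1)//.
  by apply/funext => s; rewrite qprodn.
rewrite (_ : (fun s => _) =
  fun s : R => qprod (expR (- s)) n 0 * (1 - expR (- s) ^+ n.+1)); last first.
  by apply/funext => s; rewrite qprodS.
apply: measurable_funM => //; apply: measurable_funB => //.
exact: measurable_funX.
Qed.

(** Integrating the sandwich gives finiteness and the estimate together; subtraction takes place
    only once all values are known to be real. *)
Lemma qprod_tail_moment k n : exists2 v : R,
  (\int[mu]_(s in D) (k.+1%:R * s ^+ k * (1 - qprod (expR (- s)) n 0))%:E = v%:E)%E &
  `|v - (exps_moment k (pent_exps true n) - exps_moment k (pent_exps false n))| <=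
    exps_moment k (shanks_exps n).
Proof.
pose g s : R := k.+1%:R * s ^+ k * (1 - qprod (expR (- s)) n 0).
have q01 s : D s -> 0 <= expR (- s) <= 1.
  by rewrite /D /= in_itv/= andbT => s0; rewrite expR_ge0 /= -expR0 ler_expR oppr_le0 ltW.
have w0 s : D s -> 0 <= k.+1%:R * s ^+ k.
  by rewrite /D /= in_itv/= andbT => s0; rewrite mulr_ge0// exprn_ge0// ltW.
have g0 s : D s -> (0 <= (g s)%:E)%E.
  move=> Ds; rewrite lee_fin mulr_ge0 ?w0//.
  by have /andP[_] := qprod_itv (expR (- s)) n 0 (q01 _ Ds); rewrite subr_ge0.
have mg : measurable_fun D (fun s => (g s)%:E).
  apply/measurable_EFinP; apply: measurable_funTS; apply: measurable_funM => //.
  by apply: measurable_funB => //; exact: measurable_qprod.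
set r0 := pent_exps false n; set r1 := pent_exps true n; set r2 := shanks_exps n.
have gt0 r : {subset r <= r0 ++ r1 ++ r2} -> forall e, e \in r -> (0 < e)%N.
  move=> sr e /sr; rewrite !mem_cat => /or3P[] he;
    [exact: pent_exps_gt0 he|exact: pent_exps_gt0 he|exact: shanks_exps_gt0 he].
have I r : {subset r <= r0 ++ r1 ++ r2} ->
    (\int[mu]_(s in D) (exps_tail k r s)%:E = (exps_moment k r)%:E)%E.
  by move=> sr; apply: integral_exps_tail; exact: gt0.
have s0 : {subset r0 <= r0 ++ r1 ++ r2} by move=> e; rewrite !mem_cat => ->.
have s1 : {subset r1 <= r0 ++ r1 ++ r2} by move=> e; rewrite !mem_cat => ->; rewrite orbT.
have s02 : {subset r0 ++ r2 <= r0 ++ r1 ++ r2}.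
  by move=> e; rewrite !mem_cat => /orP[->|->]; rewrite ?orbT.
have s12 : {subset r1 ++ r2 <= r0 ++ r1 ++ r2}.
  by move=> e; rewrite !mem_cat => /orP[->|->]; rewrite ?orbT.
have Mcat a b : exps_moment k (a ++ b) = exps_moment k a + exps_moment k b.
  by rewrite /exps_moment big_cat.
have H1 : (\int[mu]_(s in D) (g s)%:E + (exps_moment k r0)%:E <=
           (exps_moment k (r1 ++ r2))%:E)%E.
  rewrite -(I r0)// -(I (r1 ++ r2))// -ge0_integralD//; try exact: exps_tail_ge0; try exact: measurable_exps_tail.
  apply: ge0_le_integral => //.
  - by move=> s Ds; apply: adde_ge0; [exact: g0|exact: exps_tail_ge0].
  - by apply: emeasurable_funD => //; exact: measurable_exps_tail.
  - exact: measurable_exps_tail.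
  move=> s Ds; rewrite -EFinD lee_fin -mulrDr ler_wpM2l ?w0//.
  by have [] := pent_sandwich (expR (- s)) n (q01 _ Ds).
have H2 : ((exps_moment k r1)%:E <= \int[mu]_(s in D) (g s)%:E +
           (exps_moment k (r0 ++ r2))%:E)%E.
  rewrite -(I r1)// -(I (r0 ++ r2))// -ge0_integralD//; try exact: exps_tail_ge0; try exact: measurable_exps_tail.
  apply: ge0_le_integral => //.
  - by move=> s Ds; exact: exps_tail_ge0.
  - exact: measurable_exps_tail.
  - by apply: emeasurable_funD => //; exact: measurable_exps_tail.
  move=> s Ds; rewrite -EFinD lee_fin -mulrDr ler_wpM2l ?w0//.
  by have [] := pent_sandwich (expR (- s)) n (q01 _ Ds).
have I0 : (0 <= \int[mu]_(s in D) (g s)%:E)%E by exact: integral_ge0.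
(* [H1] excludes the value +oo and nonnegativity excludes -oo. *)
move: H1 H2 I0; rewrite -/(g _); case: (integral _ _ _) => [v| |].
- rewrite -!EFinD !lee_fin !Mcat => H1 H2 _; exists v => //.
  by rewrite ler_norml; apply/andP; split; lra.
- by rewrite addye// leye_eq.
- by move=> _ _; rewrite leeNy_eq.
Qed.

End tail_sandwich.

(** * The maximum of independent exponential variables *)

Section running_max.
Context {R : realType} {d : measure_display} {T : measurableType d}.
Implicit Types (X : nat -> T -> R) (n : nat) (w : T).

(** Starting at 0 makes the maximum nonnegative at every sample point, as the tail formula requires,
    although the variables are nonnegative only almost surely. *)
Fixpoint running_max X n w : R :=
  if n is n'.+1 then Num.max (running_max X n' w) (X n' w) else 0.

Lemma running_max_ge0 X n w : 0 <= running_max X n w.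
Proof. by elim: n => [//|n IH] /=; rewrite le_max IH. Qed.

Lemma running_max_le X n w s : 0 <= s ->
  (running_max X n w <= s) <-> (forall i, (i < n)%N -> X i w <= s).
Proof.
move=> s0; elim: n => [|n IH] /=; first by rewrite s0.
rewrite ge_max; split=> [/andP[/IH h Xn] i|h].
  by rewrite ltnS leq_eqVlt => /predU1P[->|/h].
by rewrite h// andbT; apply/IH => i iN; rewrite h// ltnS ltnW.
Qed.

Lemma running_max_nondecreasing X w : nondecreasing_seq (fun n => running_max X n w).
Proof. by apply/nondecreasing_seqP => n /=; rewrite le_max lexx. Qed.

Lemma measurable_running_max X n : (forall i, measurable_fun setT (X i)) ->
  measurable_fun setT (running_max X n).
Proof.
move=> mX; elim: n => [|n IH]; first exact: measurable_cst.
exact: measurable_maxr.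
Qed.

(** Nonnegativity of the first variable makes the initial 0 invisible to the supremum. Powers follow
    by products of limits; 0 times +oo cannot occur because both factors are powers of the same
    supremum. *)
Lemma cvg_running_max_expe X k w : 0 <= X 0%N w ->
  ((running_max X n w ^+ k)%:E @[n --> \oo] -->
   (ereal_sup (range (fun i => (X i w)%:E))) ^+ k)%E.
Proof.
move=> X0; set M := ereal_sup _.
have M0 : (0 <= M)%E.
  by apply: (@le_trans _ _ (X 0%N w)%:E); [rewrite lee_fin|apply: ereal_sup_ubound; exists 0%N].
have h1 : ((running_max X n w)%:E @[n --> \oo] --> M)%E.
  have -> : M = ereal_sup (range (fun n => (running_max X n w)%:E)).
    apply/eqP; rewrite eq_le; apply/andP; split; apply: ge_ereal_sup => _ [n _ <-].
      apply: (@le_trans _ _ (running_max X n.+1 w)%:E).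
        by rewrite lee_fin /= le_max lexx orbT.
      by apply: ereal_sup_ubound; exists n.+1.
    elim: n => [//|n IH] /=; rewrite EFin_max ge_max IH /=.
    by apply: ereal_sup_ubound; exists n.
  apply: ereal_nondecreasing_cvgn => m n mn; rewrite lee_fin.
  exact: running_max_nondecreasing.
elim: k => [|k IH].
  by rewrite expe0; exact: (@cvg_cst (\bar R) 1%E nat \oo _).
rewrite expeS; under eq_cvg do rewrite exprS EFinM.
apply: cvgeM => //; move: M0; clear; case: M => [r _|_|//].
  by rewrite mule_def_fin// -EFin_expe.
by rewrite mule_def_infty_neq0// gt_eqF// expe_gt0.
Qed.

End running_max.

Section exponential_cdf.
Context {R : realType}.
Implicit Types (rate s : R).

Lemma exponential_prob_itvNyo0 rate : exponential_prob rate `]-oo, 0%R[ = 0%E.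
Proof.
apply: integral0_eq => x; rewrite /= in_itv /= => x0.
by rewrite lt0_exponential_pdf.
Qed.

Lemma exponential_prob_itvNyc rate s : 0 < s ->
  exponential_prob rate `]-oo, s] = (1 - expR (- rate * s))%:E.
Proof.
move=> s0; rewrite EFinB -exponential_prob_itv0c// /exponential_prob.
rewrite integral_mkcond [RHS]integral_mkcond; apply: eq_integral => x _.
rewrite !patchE; case: ifPn; rewrite ?inE ?notin_setE /= !in_itv/= => xs; last first.
  by case: ifPn => //; rewrite inE /= in_itv/= => /andP[_ /xs].
case: ifPn => //; rewrite notin_setE /= in_itv/= xs andbT => /negP.
by rewrite -ltNge => x0; rewrite lt0_exponential_pdf.
Qed.

End exponential_cdf.

Section max_exponential.
Context {R : realType} {d : measure_display} {T : measurableType d}.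
Context (P : probability T R) (X : nat -> {RV P >-> R}).
Hypothesis Xindep : mutually_independent P (fun i => X i).
Hypothesis Xexp : forall (i : nat) (A : set R), measurable A ->
  distribution P (X i) A = exponential_prob (i.+1)%:R A.

Let Y n w : R := running_max (fun i => X i) n w.

Let mX i : measurable_fun setT (X i). Proof. exact: measurable_funPT. Qed.

Let mY n : measurable_fun setT (Y n).
Proof. exact: measurable_running_max. Qed.

(** By independence the distribution function is the product of the P(X_i <= s), and rate i + 1
    gives 1 - q^(i+1) with q = e^(-s). *)
Lemma tail_running_max n s : 0 < s ->
  P [set w | s < Y n w] = (1 - qprod (expR (- s)) n 0)%:E.
Proof.
move=> s0.
have mA : measurable [set w | Y n w <= s].
  have : measurable_fun setT (fun w => Y n w <= s) by exact: measurable_fun_ler.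
  by move=> /(_ measurableT [set true]); rewrite setTI; exact.
rewrite (_ : [set w | s < Y n w] = ~` [set w | Y n w <= s]); last first.
  by apply/seteqP; split => w /=; rewrite ltNge => /negP.
rewrite probability_setC// EFinB; congr (_ - _)%E.
rewrite (_ : [set w | Y n w <= s] =
    \bigcap_(i in [set` iota 0 n]) (X i @^-1` `]-oo, s])); last first.
  apply/seteqP; split => w /=.
    move=> /(running_max_le _ _ _ _ (ltW s0)) h i /=.
    by rewrite mem_iota /= add0n in_itv/= => /h.
  move=> h; apply/(running_max_le _ _ _ _ (ltW s0)) => i iN.
  by have := h i; rewrite /= mem_iota /= add0n in_itv/=; exact.
rewrite (Xindep (iota 0 n) (fun=> `]-oo, s]%classic)) ?iota_uniq//.
under eq_bigr => i _.
  rewrite -[P _]/(distribution P (X i) `]-oo, s]) Xexp; last exact: measurable_itv.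
  rewrite exponential_prob_itvNyc// mulNr -mulrN expRM_natl; over.
rewrite /qprod big_add1 /= /index_iota subn0.
by elim: (iota 0 n) => [|i r IH]; rewrite ?big_nil// !big_cons IH.
Qed.

Lemma ae_first_ge0 : {ae P, forall w, 0 <= X 0%N w}.
Proof.
exists (X 0%N @^-1` `]-oo, 0%R[); split.
- by rewrite -[X in measurable X]setTI; apply: mX => //; exact: measurable_itv.
- rewrite -[LHS]/(distribution P (X 0%N) `]-oo, 0%R[) Xexp; last exact: measurable_itv.
  exact: exponential_prob_itvNyo0.
- by move=> w /= /negP; rewrite -ltNge in_itv.
Qed.

(** Monotone convergence identifies the limit with the integral of the pointwise limit, which equals
    the power of the supremum outside the null set where the first variable is negative. *)
Lemma cvg_moment_running_max k :
  (\int[P]_w (Y n w ^+ k)%:E @[n --> \oo] -->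
   \int[P]_w ((ereal_sup (range (fun i => (X i w)%:E))) ^+ k))%E.
Proof.
have mYk n : measurable_fun setT (fun w => (Y n w ^+ k)%:E).
  by apply/measurable_EFinP; exact: measurable_funX.
have ndY w : nondecreasing_seq (fun n => (Y n w ^+ k)%:E).
  move=> m n mn; rewrite lee_fin lerXn2r ?nnegrE ?running_max_ge0//.
  exact: running_max_nondecreasing.
have -> : (\int[P]_w ((ereal_sup (range (fun i => (X i w)%:E))) ^+ k))%E =
    (\int[P]_w limn (fun n => (Y n w ^+ k)%:E))%E.
  apply: ae_eq_integral => //.
  - elim: k {mYk ndY} => [|j IH].
      by rewrite (_ : (fun w => _) = cst 1%E)//; apply/funext => w; rewrite expe0.
    rewrite (_ : (fun w => _) = (fun w => ereal_sup (range (fun i => (X i w)%:E)) *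
      (ereal_sup (range (fun i => (X i w)%:E))) ^+ j)%E); last first.
      by apply/funext => w; rewrite expeS.
    apply: emeasurable_funM IH.
    have := @measurable_fun_esups _ _ _ setT (fun i w => (X i w)%:E).
    move=> /(_ _ 0%N); rewrite /esups /=.
    rewrite (_ : (fun x => ereal_sup (sdrop _ 0)) =
      fun w => ereal_sup (range (fun i => (X i w)%:E))).
      by apply=> i; exact/measurable_EFinP.
    apply/funext => w; congr ereal_sup; apply/seteqP.
    by split=> _ [i _ <-]; exists i.
  - apply: (emeasurable_fun_cvg (fun n w => (Y n w ^+ k)%:E)) => // w _.
    exact: ereal_nondecreasing_is_cvgn.
  - have [N [mN N0 sN]] := ae_first_ge0; exists N; split=> // w /= nh; apply: sN.
    move=> /= X0; apply: nh => _; apply/esym/cvg_lim => //.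
    exact: cvg_running_max_expe.
apply: cvg_monotone_convergence => //.
by move=> n w _; rewrite lee_fin exprn_ge0// running_max_ge0.
Qed.

End max_exponential.

(** * Limit of the signed pentagonal moments *)

Section moment_limit.
Context {R : realType}.

Lemma pent1E j : (pent1 j)%:R = j%:R * (3 * j%:R - 1) / 2 :> R.
Proof.
have := mul_bin_diag j 1; rewrite bin1 => /(congr1 (GRing.natmul (1 : R))).
rewrite /pent1 natrD !natrM; case: j => [|j] /= h; first by lra.
have -> : 'C(j.+1, 2)%:R = j.+1%:R * j%:R / 2 :> R by lra.
by rewrite -natr1; field.
Qed.

Lemma pent2E j : (pent2 j)%:R = j%:R * (3 * j%:R + 1) / 2 :> R.
Proof.
have := mul_bin_diag j.+1 1; rewrite bin1 => /(congr1 (GRing.natmul (1 : R))).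
rewrite /pent2 natrD !natrM /= => h.
have -> : 'C(j.+1, 2)%:R = j.+1%:R * j%:R / 2 :> R by lra.
by rewrite -natr1; field.
Qed.

Lemma exps_moment_diff k n :
  exps_moment k (pent_exps true n) - exps_moment k (pent_exps false n) =
  - (k.+1`!%:R * \sum_(1 <= j < n.+1) (-1) ^+ j *
      ((j%:R * (3 * j%:R - 1) / 2)^-1 ^+ k.+1 +
       (j%:R * (3 * j%:R + 1) / 2)^-1 ^+ k.+1)) :> R.
Proof.
rewrite /exps_moment (sum_pent_exps (fun e => k.+1`!%:R * e%:R^-1 ^+ k.+1 : R)).
congr (- _); rewrite mulr_sumr; apply: eq_bigr => j _.
by rewrite -mulrDr mulrCA pent1E pent2E.
Qed.

Lemma cvg_exps_moment_diff k :
  exps_moment k (pent_exps true n) - exps_moment k (pent_exps false n)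
  @[n --> \oo] --> k.+1`!%:R * (-6) ^+ k.+1 *
    \sum_(1 <= m < k.+2) 'C(2 * k.+1 - m - 1, k.+1 - 1)%:R * (1 - pent_lim m : R).
Proof.
have h := @cvg_pent_series R k.+1 isT.
rewrite (_ : (fun n => _) = (fun n => - k.+1`!%:R * \sum_(1 <= j < n.+1) (-1) ^+ j *
      ((j%:R * (3 * j%:R - 1) / 2)^-1 ^+ k.+1 +
       (j%:R * (3 * j%:R + 1) / 2)^-1 ^+ k.+1) : R)); last first.
  by apply/funext => n; rewrite exps_moment_diff mulNr.
rewrite -mulrA -mulrNN; exact: cvgMr h.
Qed.

End moment_limit.

(* X i here is X_{i+1} of the paper: X i ~ Exp(i+1), i : nat. *)
Theorem theorem4 (R : realType) (d : measure_display) (T : measurableType d)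
  (P : probability T R) (X : nat -> {RV P >-> R})
  (Xindep : mutually_independent P (fun i => X i))
  (Xexp : forall (i : nat) (A : set R), measurable A ->
     distribution P (X i) A = exponential_prob (i.+1)%:R A)
  (k : nat) (hk : (0 < k)%N) :
  (\int[P]_w ((ereal_sup (range (fun i => (X i w)%:E))) ^+ k))%E =
  ((k`!)%:R * (-6) ^+ k *
    ( 'C(2 * k - 1, k)%:R
      - 2 * pi / (3 * Num.sqrt 3) * 'C(2 * k - 2, k - 1)%:R
      + \sum_(1 <= j < (k./2).+1)
          ((-1) ^+ j * pi ^+ (2 * j) * bernoulli (2 * j) / ((2 * j)`!)%:R
           * (2 ^+ (2 * j - 1) - 1) * (1 - 3 / 3 ^+ (2 * j))
           * 'C(2 * k - 2 * j - 1, k - 1)%:R)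
      - 2 / Num.sqrt 3 *
        \sum_(1 <= j < ((k.-1)./2).+1)
          ((pi / 3) ^+ (2 * j + 1) * (-1) ^+ j
           * 'C(2 * k - 2 * j - 2, k - 1)%:R
           * ((3 * j + 1)%:R / ((2 * j + 1)`!)%:R
              - 3 * \sum_(1 <= l < j.+1)
                  (6 ^+ (2 * l - 1) * bernoulli (2 * l)
                   / (((2 * j - 2 * l + 1)`!)%:R * ((2 * l)`!)%:R))))))%:E.
Proof.
(* With the closed form folded back into the sum over m, both sides become limits of the moments of
   the running maxima, and uniqueness of limits concludes. *)
rewrite -sum_pent_lim//; case: k hk => // k _.
set Y := running_max (fun i => X i).
have tail n : exists v : R, (\int[P]_w (Y n w ^+ k.+1)%:E = v%:E)%E /\
    `|v - (exps_moment k (pent_exps true n) - exps_moment k (pent_exps false n))| <=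
      exps_moment k (shanks_exps n).
  have [v vE vle] := @qprod_tail_moment R k n.
  exists v; split=> //; rewrite moment_tail -?vE; last 2 first.
  - by apply: measurable_running_max => i; exact: measurable_funPT.
  - by move=> w; exact: running_max_ge0.
  apply: eq_integral => s; rewrite inE /= in_itv/= andbT => s0.
  by rewrite (tail_running_max P X Xindep Xexp)// -EFinM.
have [v vP] := choice tail.
have := cvg_moment_running_max P X Xexp k.+1.
rewrite (_ : (fun n => _) = (fun n => (v n)%:E)); last first.
  by apply/funext => n; have [] := vP n.
move=> h; apply: (cvg_unique (@ereal_hausdorff R) h).
apply: cvg_EFin; first exact: nearW.
have err : exps_moment k (shanks_exps n) @[n --> \oo] --> (0 : R).
  rewrite (_ : (fun n => _) = fun n =>
      k.+1`!%:R * \sum_(e <- shanks_exps n) (e%:R^-1 ^+ k.+1 : R)); last first.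
    by apply/funext => n; rewrite mulr_sumr.
  rewrite -[X in _ --> X](mulr0 (k.+1`!%:R : R)).
  by apply: cvgMr; exact: cvg_shanks_exps.
(* The moments [v n] differ from the signed pentagonal sums by at most the Shanks error, which tends
   to 0. *)
apply: cvg_sub0 (cvg_exps_moment_diff k).
apply: norm_cvg0; apply: squeeze_cvgr err; last exact: cvg_cst.
by apply: nearW => n; rewrite normr_ge0 /=; have [] := vP n.
Qed.
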